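(* Let $\varphi_p:\operatorname{Int}(\mathcal{M}_k(\mathbb{R}))\to(0_p,I_p)^k$ be the bijection mapping a moment vector $(S_1,\dots,S_k)^T$ to its vector of symmetric canonical moments $(U_1,\dots,U_k)^T$. Then $\varphi_p^{-1}:(0_p,I_p)^k\to\operatorname{Int}(\mathcal{M}_k(\mathbb{R}))$ is matrix differentiable at $\mathbf{U^0}=\tfrac12(I_p,\dots,I_p)^T$ with $$\frac{\partial\varphi_p^{-1}}{\partial\mathbf{U}}(\mathbf{U^0})=A\otimes I_p,$$ where $A$ is the $k\times k$ lower triangular matrix with $a_{i,j}=2^{-2i+2}\binom{2i}{i-j}$ for $j\le i$ and $a_{i,j}=0$ for $j>i$.
   Context: $\mathcal{S}_p(\mathbb{R})$: real symmetric $p\times p$ matrices; $(0_p,I_p)=\{X\in\mathcal{S}_p(\mathbb{R}):0_p<X<I_p\}$ (Loewner order). A real matrix measure on $[0,1]$: $p\times p$ matrix of signed Borel measures with $\mu(B)$ symmetric nonnegative definite, $\mu([0,1])=I_p$; $S_j=\int_0^1x^jd\mu$, $S_0=I_p$; $\mathcal{M}_k(\mathbb{R})$ is the set of moment vectors $(S_1,\dots,S_k)^T$. With block Hankel matrices $\underline H_{2m}=(S_{i+j})_{i,j=0}^m$, $\overline H_{2m}=(S_{i+j+1}-S_{i+j+2})_{i,j=0}^{m-1}$, $\underline H_{2m+1}=(S_{i+j+1})_{i,j=0}^m$, $\overline H_{2m+1}=(S_{i+j}-S_{i+j+1})_{i,j=0}^m$ and block vectors $\underline h_{2m}=(S_{m+1},\dots,S_{2m})^T$,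 $\underline h_{2m-1}=(S_m,\dots,S_{2m-1})^T$, $\bar h_{2m}=(S_m-S_{m+1},\dots,S_{2m-1}-S_{2m})^T$, $\bar h_{2m-1}=(S_m-S_{m+1},\dots,S_{2m-2}-S_{2m-1})^T$, set $S_1^-=0_p$, $S_1^+=I_p$, $S_2^+=S_1$, $S^-_{n+1}=\underline h_n^T\underline H_{n-1}^{-1}\underline h_n$, $S^+_{n+1}=S_n-\bar h_n^T\overline H_{n-1}^{-1}\bar h_n$. On $\operatorname{Int}(\mathcal{M}_k(\mathbb{R}))=\{S_j^-<S_j<S_j^+\ \forall j\le k\}$ the symmetric canonical moments are $U_j=(S_j^+-S_j^-)^{-1/2}(S_j-S_j^-)(S_j^+-S_j^-)^{-1/2}$, and $\varphi_p$ is a bijection onto $(0_p,I_p)^k$. Matrix differentiability: for an open $\mathcal{S}\subset(\mathcal{S}_p(\mathbb{R}))^n$, elements of which are regarded as $np\times p$ block columns, a map $\Phi:\mathcal{S}\to(\mathbb{R}^{p\times p})^m$ is matrix differentiable at $\mathbf{M^0}\in\mathcal{S}$ if there is a real matrix $\mathbf{L}\in\mathbb{R}^{mp\times np}$ such that $\Phi(\mathbf{M^0}+\mathbf{H})-\Phi(\mathbf{M^0})=\mathbf{L}\mathbf{H}+o(\|\mathbf{H}\|)$ as $\mathbf{H}\to0$ in $(\mathcal{S}_p(\mathbb{R}))^n$; then $\frac{\partial\Phi}{\partial\mathbf{M}}(\mathbf{M^0}):=\mathbf{L}$. $\otimes$ is the Kronecker product. *)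

(* Defs.v *)
From HB Require Import structures.
From mathcomp Require Import all_boot all_order all_algebra.
From Stdlib Require Import ClassicalEpsilon.
Set Implicit Arguments. Unset Strict Implicit. Unset Printing Implicit Defensive.
Import Order.TTheory GRing.Theory Num.Theory.
Local Open Scope ring_scope.

Section MomentDefs.
Variable R : rcfType.

Definition ent (a b : nat) (M : 'M[R]_(a, b)) (i j : nat) : R :=
  match @insub _ (fun x => x < a)%N _ i, @insub _ (fun x => x < b)%N _ j with
  | Some i', Some j' => M i' j'
  | _, _ => 0
  end.

Definition blockmx (p m n : nat) (B : nat -> nat -> 'M[R]_p) : 'M[R]_(m * p, n * p) :=
  \matrix_(r, c) ent (B (r %/ p)%N (c %/ p)%N) (r %% p)%N (c %% p)%N.
Arguments blockmx p m n B : clear implicits.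

Definition blockcol (p m : nat) (B : nat -> 'M[R]_p) : 'M[R]_(m * p, p) :=
  \matrix_(r, c) ent (B (r %/ p)%N) (r %% p)%N c.
Arguments blockcol p m B : clear implicits.

Definition blk (p k : nat) (M : 'M[R]_(k * p, p)) (j : nat) : 'M[R]_p :=
  \matrix_(a, b) ent M (j * p + a)%N b.

Definition kronI (p k : nat) (A : 'M[R]_k) : 'M[R]_(k * p) :=
  blockmx p k k (fun i j => ent A i j *: 1%:M).

Definition sym (p : nat) (X : 'M[R]_p) : Prop := X^T = X.
Definition posdef (p : nat) (X : 'M[R]_p) : Prop :=
  sym X /\ forall v : 'rV[R]_p, v != 0 -> 0 < (v *m X *m v^T) 0 0.
Definition psd (p : nat) (X : 'M[R]_p) : Prop :=
  sym X /\ forall v : 'rV[R]_p, 0 <= (v *m X *m v^T) 0 0.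
Definition loew_lt (p : nat) (X Y : 'M[R]_p) : Prop := sym X /\ sym Y /\ posdef (Y - X).

Definition msqrt (p : nat) (X : 'M[R]_p) : 'M[R]_p :=
  epsilon (inhabits 0) (fun Y => psd Y /\ Y *m Y = X).

(* the sequence S_0 = I_p, S_1, ..., S_k read off a block column (S_1,...,S_k)^T *)
Definition Sseq (p k : nat) (M : 'M[R]_(k * p, p)) (j : nat) : 'M[R]_p :=
  if j is j'.+1 then blk M j' else 1%:M.

(* S^-_{n+1} and S^+_{n+1} for n >= 1, computed from S = Sseq M:
   S^-_{n+1} = h_n^T H_{n-1}^{-1} h_n  where
     h_n     has uphalf n blocks S_{n/2+1+i},
     H_{n-1} has uphalf n x uphalf n blocks S_{i+j+[n even]};
   S^+_{n+1} = S_n - hb_n^T Hb_{n-1}^{-1} hb_n  where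
     hb_n     has n/2 blocks S_{uphalf n + i} - S_{uphalf n + i + 1},
     Hb_{n-1} has n/2 x n/2 blocks S_{i+j+[n odd]} - S_{i+j+[n odd]+1}. *)
Definition Sminus_step (p : nat) (S : nat -> 'M[R]_p) (n : nat) : 'M[R]_p :=
  let c := uphalf n in
  let h := blockcol p c (fun i => S (n./2 + 1 + i)%N) in
  let H := blockmx p c c (fun i j => S (i + j + ~~ odd n)%N) in
  h^T *m invmx H *m h.

Definition Splus_step (p : nat) (S : nat -> 'M[R]_p) (n : nat) : 'M[R]_p :=
  let c := n./2 in
  let h := blockcol p c (fun i => S (uphalf n + i)%N - S (uphalf n + i + 1)%N) in
  let H := blockmx p c c (fun i j => S (i + j + odd n)%N - S (i + j + odd n + 1)%N) in
  S n - h^T *m invmx H *m h.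

(* S_j^- and S_j^+ for j >= 1 (S_1^- = 0, S_1^+ = I_p; S_2^+ = S_1 results) *)
Definition Sminus (p : nat) (S : nat -> 'M[R]_p) (j : nat) : 'M[R]_p :=
  match j with
  | 0 | 1 => 0
  | n.+1 => Sminus_step S n
  end.

Definition Splus (p : nat) (S : nat -> 'M[R]_p) (j : nat) : 'M[R]_p :=
  match j with
  | 0 | 1 => 1%:M
  | n.+1 => Splus_step S n
  end.

(* elements of (S_p(R))^k, regarded as kp x p block columns *)
Definition symblocks (p k : nat) (M : 'M[R]_(k * p, p)) : Prop :=
  forall j, (j < k)%N -> sym (blk M j).

Definition IntMk (p k : nat) (M : 'M[R]_(k * p, p)) : Prop :=
  symblocks M /\
  forall j, (1 <= j <= k)%N ->
    loew_lt (Sminus (Sseq M) j) (Sseq M j) /\ loew_lt (Sseq M j) (Splus (Sseq M) j).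

Definition unitbox (p k : nat) (U : 'M[R]_(k * p, p)) : Prop :=
  symblocks U /\ forall j, (j < k)%N -> loew_lt 0 (blk U j) /\ loew_lt (blk U j) 1%:M.

Definition canmom (p : nat) (S : nat -> 'M[R]_p) (j : nat) : 'M[R]_p :=
  let D := invmx (msqrt (Splus S j - Sminus S j)) in
  D *m (S j - Sminus S j) *m D.

Definition phi (p k : nat) (M : 'M[R]_(k * p, p)) : 'M[R]_(k * p, p) :=
  blockcol p k (fun i => canmom (Sseq M) i.+1).

Definition phi_inv (p k : nat) (U : 'M[R]_(k * p, p)) : 'M[R]_(k * p, p) :=
  epsilon (inhabits 0) (fun M => IntMk M /\ phi M = U).

(* sum-of-absolute-values norm (all norms are equivalent) *)
Definition mnorm (a b : nat) (M : 'M[R]_(a, b)) : R := \sum_i \sum_j `|M i j|.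

Definition mx_diff_at (p n m : nat) (Phi : 'M[R]_(n * p, p) -> 'M[R]_(m * p, p))
  (M0 : 'M[R]_(n * p, p)) (L : 'M[R]_(m * p, n * p)) : Prop :=
  forall eps : R, 0 < eps -> exists2 delta : R, 0 < delta &
    forall H : 'M[R]_(n * p, p), symblocks H -> mnorm H < delta ->
      mnorm (Phi (M0 + H) - Phi M0 - L *m H) <= eps * mnorm H.

Definition U0 (p k : nat) : 'M[R]_(k * p, p) := blockcol p k (fun _ => 2^-1 *: 1%:M).

(* A = (a_ij), a_ij = 2^{-2i+2} binom(2i, i-j) for j <= i (1-based), 0 otherwise *)
Definition Amat (k : nat) : 'M[R]_k :=
  \matrix_(i, j) if (j <= i)%N
                 then (2 ^+ (2 * i))^-1 * ('C(2 * i.+1, i - j))%:R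
                 else 0.

End MomentDefs.

(* Main.v *)
Require Import Defs.
From HB Require Import structures.
From mathcomp Require Import all_boot all_order all_algebra.
From mathcomp Require Import ring lra zify.
From mathcomp Require Import spectral sesquilinear complex.
Set Implicit Arguments. Unset Strict Implicit. Unset Printing Implicit Defensive.
Import Order.TTheory GRing.Theory Num.Theory.
Local Open Scope ring_scope.

(* At U^0 all moments are scalar: S_j = c_j I with c_j the moments of the arcsine
   law. For any monic f, completing the square writes a Schur complement
   h^T H^-1 h as a linear functional of the moments plus y^T H^-1 y, where y is the
   residual of f against the Hankel matrix. Taking for f the orthogonal polynomials
   of the arcsine law (weights 1, x, 1-x and x(1-x), all of Chebyshev type), y
   vanishes at U^0, so that this error is quadratic. With x = cos^2 t,
   the weighted squares of these polynomials are 4^-n cos^2((n+1)t) and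
   4^-n sin^2((n+1)t): their sum is constant, hence S^+ - S^- = 4^-n I up to second
   order, and their difference is 4^-n T_(n+1)(2x-1), whence
     L_S(T_(n+1)(2x-1)) = 2 H_(n+1) + o(H)
   for the perturbation H of U^0, L_S being the moment functional. The solution
   of this triangular system is the Fourier expansion of cos^(2i), i.e. the
   binomials of A. Since U^0 is scalar, only the continuity of the
   square root at multiples of I enters, never its derivative. *)

(** * Chebyshev polynomials and arcsine moments *)

Section Moment.
Variables (R : fieldType) (V : lmodType R).
Implicit Types (s : nat -> V) (f g : {poly R}).

(** The moment functional [L_s]. Values in a module let the same lemmas serve the scalar arcsine
    moments and the matrix moments. *)
Definition mom s f : V := \sum_(i < size f) f`_i *: s i.

Lemma mom_wide s f N : (size f <= N)%N -> mom s f = \sum_(i < N) f`_i *: s i.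
Proof.
move=> le_fN; rewrite /mom (big_ord_widen_cond N xpredT (fun i => f`_i *: s i)) //.
rewrite big_mkcond /=; apply: eq_bigr => i _; case: ltnP => // le_fi.
by rewrite nth_default // scale0r.
Qed.

Lemma momD s f g : mom s (f + g) = mom s f + mom s g.
Proof.
set N := maxn (size f) (size g).
rewrite !(@mom_wide s _ N) ?leq_maxl ?leq_maxr ?(leq_trans (size_polyD _ _)) //.
by rewrite -big_split; apply: eq_bigr => i _; rewrite coefD scalerDl.
Qed.

Lemma momZ s a f : mom s (a *: f) = a *: mom s f.
Proof.
rewrite !(@mom_wide s _ (size f)) ?size_scale_leq // scaler_sumr.
by apply: eq_bigr => i _; rewrite coefZ scalerA.
Qed.

Lemma momN s f : mom s (- f) = - mom s f.
Proof. by rewrite -(scaleN1r f) momZ scaleN1r. Qed.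

Lemma momB s f g : mom s (f - g) = mom s f - mom s g.
Proof. by rewrite momD momN. Qed.

Lemma mom_sum s n (F : 'I_n -> {poly R}) :
  mom s (\sum_(i < n) F i) = \sum_(i < n) mom s (F i).
Proof.
elim: n F => [|n IHn] F; first by rewrite !big_ord0 /mom size_poly0 big_ord0.
by rewrite !big_ord_recr momD IHn.
Qed.

Lemma mom1 s : mom s 1 = s 0%N.
Proof. by rewrite /mom size_poly1 big_ord1 coef1 scale1r. Qed.

Lemma momXn s n f : mom s ('X^n * f) = mom (fun i => s (i + n)%N) f.
Proof.
have szl : (size ('X^n * f)%R <= n + size f)%N.
  by apply: leq_trans (size_polyMleq _ _) _; rewrite size_polyXn.
rewrite (mom_wide s szl) big_split_ord /= big1 ?add0r => [|i _].
  by apply: eq_bigr => i _; rewrite coefXnM ltnNge leq_addr addKn addnC.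
by rewrite coefXnM ltn_ord scale0r.
Qed.

Lemma momX s f : mom s ('X * f) = mom (fun i => s i.+1) f.
Proof. by rewrite -['X]expr1 momXn; apply: eq_bigr => i _; rewrite addn1. Qed.

Lemma momMl s f g : mom s (f * g) = \sum_(i < size f) f`_i *: mom s ('X^i * g).
Proof.
rewrite -{1}[f]coefK poly_def mulr_suml mom_sum.
by apply: eq_bigr => i _; rewrite -scalerAl momZ.
Qed.

Lemma mom_seqD s1 s2 f : mom (fun i => s1 i + s2 i) f = mom s1 f + mom s2 f.
Proof. by rewrite -big_split; apply: eq_bigr => i _; rewrite scalerDr. Qed.

Lemma mom_seqB s1 s2 f : mom (fun i => s1 i - s2 i) f = mom s1 f - mom s2 f.
Proof. by rewrite -sumrB; apply: eq_bigr => i _; rewrite scalerBr. Qed.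

Lemma mom_scaled (c : nat -> R^o) (v : V) f :
  mom (fun i => c i *: v) f = (\sum_(i < size f) f`_i * c i) *: v.
Proof. by rewrite scaler_suml; apply: eq_bigr => i _; rewrite scalerA. Qed.

End Moment.

Section Chebyshev.
Variable R : rcfType.
Implicit Types (m n i j l : nat).

(* The [m]-th coefficient of the Fourier expansion of [cos^j]. *)
Fixpoint cosmom j m : R :=
  match j, m with
  | 0, 0 => 1
  | 0, _.+1 => 0
  | j'.+1, 0 => cosmom j' 1
  | j'.+1, m'.+1 => 2^-1 * (cosmom j' m' + cosmom j' m'.+2)
  end.

Lemma cosmomSS j m : cosmom j.+1 m.+1 = 2^-1 * (cosmom j m + cosmom j m.+2).
Proof. by []. Qed.

Lemma cosmomS0 j : cosmom j.+1 0 = cosmom j 1.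
Proof. by []. Qed.

(** A power [cos^j] contains no frequency above [j]. The vanishing of the residuals comes down to
    this. *)
Lemma cosmom_small j m : (j < m)%N -> cosmom j m = 0.
Proof.
elim: j m => [|j IHj] [|m] //= lt_jm.
by rewrite !IHj ?addr0 ?mulr0 //; lia.
Qed.

Lemma cosmom_diag m : 0 < cosmom m m.
Proof.
elim: m => [|m IHm] //=.
by rewrite (@cosmom_small m m.+2) // addr0 mulr_gt0 // invr_gt0.
Qed.

(** The recursion of [cosmom] is Pascal's rule. It moves [m] in both directions, hence the induction
    on a bound [N] for the power. *)
Lemma cosmom_binomial m d : cosmom (m + d.*2) m = (2 ^+ (m + d.*2))^-1 * 'C(m + d.*2, d)%:R.
Proof.
move: {2}(m + d.*2)%N (leqnn (m + d.*2)) => N; elim: N m d => [|N IH] m d.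
  by rewrite leqn0 addn_eq0 double_eq0 => /andP[/eqP-> /eqP->] /=; rewrite expr0 invr1 bin0 mulr1.
case: m => [|m] le_N.
  case: d le_N => [|d] le_N; first by rewrite /= expr0 invr1 bin0 mulr1.
  rewrite add0n doubleS cosmomS0.
  have := IH 1%N d; rewrite add1n => ->; last by lia.
  (* At frequency 0 the two summands of Pascal's rule coincide by symmetry, both being
     ['C(d.*2.+1, d)]. *)
  rewrite [in RHS]binS -(@bin_sub _ d.+1); last by lia.
  have -> : (d.*2.+1 - d.+1 = d)%N by lia.
  by rewrite natrD !exprS; field; rewrite expf_neq0 // pnatr_eq0.
rewrite addSn cosmomSS IH; last by lia.
case: d le_N => [|d] le_N.
  rewrite (@cosmom_small _ m.+2); last by lia.
  by rewrite !bin0 addr0 exprS; field; rewrite expf_neq0 // pnatr_eq0.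
have -> : (m + d.+1.*2 = m.+2 + d.*2)%N by lia.
rewrite IH; last by lia.
by rewrite binS natrD exprS; field; rewrite expf_neq0 // pnatr_eq0.
Qed.

(** The average of [f(cos^2 t) cos (l t)] over a period; [l = 0] is integration against the arcsine
    law. *)
Definition momcos l f : R := mom (fun i => cosmom i.*2 l : R^o) f.

(* With x = cos^2 t, cos (m t) = (cos t)^(odd m) P_m(x) and
   sin (m t) = sin t (cos t)^(~~ odd m) Q_m(x); the recursion is the rotation by t,
   and [wP], [wQ] below are the squares of the factors in front. *)
Fixpoint chebPQ m : {poly R} * {poly R} :=
  if m is m'.+1 then
    let: (P, Q) := chebPQ m' in
    ('X^(odd m') * P - (1 - 'X) * Q, 'X^(~~ odd m') * Q + P)
  else (1, 0).
Definition chebP m := (chebPQ m).1.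
Definition chebQ m := (chebPQ m).2.
Definition wP m : {poly R} := 'X^(odd m).
Definition wQ m : {poly R} := 'X^(~~ odd m) * (1 - 'X).
(** This is [cos^2 (m t) - sin^2 (m t) = cos (2 m t)], that is, the Chebyshev polynomial
    [T_m (2 x - 1)]. *)
Definition cheb m := wP m * chebP m ^+ 2 - wQ m * chebQ m ^+ 2.

Lemma chebPS m : chebP m.+1 = wP m * chebP m - (1 - 'X) * chebQ m.
Proof. by rewrite /chebP /chebQ /=; case: (chebPQ m). Qed.

Lemma chebQS m : chebQ m.+1 = 'X^(~~ odd m) * chebQ m + chebP m.
Proof. by rewrite /chebP /chebQ /=; case: (chebPQ m). Qed.

(** Pythagoras for the angle [m t]; it is why [S^+ - S^-] is constant to first order. *)
Lemma cheb_pell m : wP m * chebP m ^+ 2 + wQ m * chebQ m ^+ 2 = 1.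
Proof.
elim: m => [|m IHm]; first by rewrite /wP /wQ /chebP /chebQ /=; ring.
rewrite chebPS chebQS -[RHS]IHm /wP /wQ /=.
by case: (odd m) => /=; rewrite ?expr0 ?expr1; ring.
Qed.

Lemma chebSS m : cheb m.+2 = (4%:R * 'X - 2%:R) * cheb m.+1 - cheb m.
Proof.
rewrite /cheb /wP /wQ !(chebPS, chebQS) /wP /=.
by case: (odd m) => /=; rewrite ?expr0 ?expr1; ring.
Qed.

Lemma cheb0 : cheb 0 = 1.
Proof. by rewrite /cheb /wP /wQ /chebP /chebQ /=; ring. Qed.

Lemma cheb1 : cheb 1 = 2%:R * 'X - 1.
Proof. by rewrite /cheb /wP /wQ !(chebPS, chebQS) /wP /chebP /chebQ /=; ring. Qed.

End Chebyshev.

(** * Orthogonality relations and Hankel matrices of the arcsine law *)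

Section ChebyshevMoments.
Variable R : rcfType.
Implicit Types (m n i j l : nat) (f : {poly R}).
Local Notation chebP := (chebP R).
Local Notation chebQ := (chebQ R).
Local Notation cheb := (cheb R).
Local Notation wP := (wP R).
Local Notation wQ := (wQ R).
Local Notation cosmom := (cosmom R).

(** In each step of the rotation the two top terms have the same degree and the same leading
    coefficient [2 ^+ n], for either parity, so this coefficient doubles. [chebP] and [chebQ] feed
    each other, hence the joint induction. *)
Lemma chebPQ_lead n :
  [/\ forall i, (uphalf n < i)%N -> (chebP n.+1)`_i = 0,
      (chebP n.+1)`_(uphalf n) = 2 ^+ n,
      forall i, (n./2 < i)%N -> (chebQ n.+1)`_i = 0 &
      (chebQ n.+1)`_(n./2) = 2 ^+ n].
Proof.
elim: n => [|n [P0 P1 Q0 Q1]].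
  rewrite chebPS chebQS /wP /chebP /chebQ /= !mulr0 mul1r subr0 add0r.
  by split=> [i||i|]; rewrite coef1 //; case: i.
have coefP' i : (chebP n.+2)`_i = ('X^(~~ odd n) * chebP n.+1)`_i
    - (chebQ n.+1)`_i + ('X * chebQ n.+1)`_i.
  have -> : chebP n.+2 = 'X^(~~ odd n) * chebP n.+1 - chebQ n.+1 + 'X * chebQ n.+1.
    by rewrite chebPS /wP /=; ring.
  by rewrite coefD coefB.
have coefQ' i : (chebQ n.+2)`_i = ('X^(odd n) * chebQ n.+1)`_i + (chebP n.+1)`_i.
  by rewrite chebQS coefD /= negbK.
have half_n := odd_double_half n; have uphalf_n := uphalf_half n.
split=> [i lt_i||i lt_i|].
- rewrite coefP' coefXnM coefXM (Q0 i); last by lia.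
  rewrite (P0 (i - ~~ odd n)%N) ?(Q0 i.-1); try by lia.
  by rewrite !if_same addr0 subr0.
- rewrite coefP' coefXnM coefXM (Q0 (uphalf n.+1)) /=; last by lia.
  rewrite Q1 exprS; move: P1; rewrite uphalf_n.
  by case: (odd n) => /= P1; rewrite ?subn0 ?subn1 /= P1; ring.
- rewrite coefQ' coefXnM (P0 i); last by lia.
  by rewrite Q0 ?if_same ?addr0 //; lia.
- rewrite coefQ' coefXnM -uphalfE P1 exprS uphalf_n.
  by case: (odd n) => /=; rewrite ?subn1 ?subn0 /= Q1; ring.
Qed.

Lemma size_chebP n : (size (chebP n.+1) <= (uphalf n).+1)%N.
Proof. by have [P0 _ _ _] := chebPQ_lead n; apply/leq_sizeP. Qed.

Lemma size_chebQ n : (size (chebQ n.+1) <= n./2.+1)%N.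
Proof. by have [_ _ Q0 _] := chebPQ_lead n; apply/leq_sizeP. Qed.

Lemma momcosX0 f : momcos 0 ('X * f) = 2^-1 * (momcos 0 f + momcos 2 f).
Proof.
rewrite /momcos momX /mom -big_split mulr_sumr; apply: eq_bigr => i _ /=.
by rewrite /GRing.scale /=; ring.
Qed.

Lemma momcosXS l f : momcos l.+1.*2 ('X * f) =
  4^-1 * (momcos l.*2 f + 2 * momcos l.+1.*2 f + momcos l.+2.*2 f).
Proof.
rewrite /momcos momX /mom mulr_sumr -!big_split mulr_sumr; apply: eq_bigr => i _ /=.
by rewrite /GRing.scale /=; field.
Qed.

Lemma momcosD l f g : momcos l (f + g) = momcos l f + momcos l g.
Proof. exact: (@momD R R^o). Qed.
Lemma momcosB l f g : momcos l (f - g) = momcos l f - momcos l g.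
Proof. exact: (@momB R R^o). Qed.
Lemma momcosMn l n f : momcos l (n%:R * f) = n%:R * momcos l f.
Proof. by rewrite -scaler_nat -scalerAl mul1r; apply: (@momZ R R^o). Qed.

(** With [x = cos^2 t], [wP n.+1 * chebP n.+1] is [cos ((n+1) t)] times [cos t] to the power
    [~~ odd n], and [wQ n.+1 * chebQ n.+1] is [sin t sin ((n+1) t)] times [cos t] to the power
    [odd n]; the product formula splits the latter into the frequencies [n] and [n+2]. *)
Lemma momcos_wPQ n i :
  momcos 0 ('X^i * (wP n.+1 * chebP n.+1)) = cosmom (i.*2 + ~~ odd n) n.+1
  /\ momcos 0 ('X^i * (wQ n.+1 * chebQ n.+1)) =
     2^-1 * (cosmom (i.*2 + odd n) n - cosmom (i.*2 + odd n) n.+2).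
Proof.
have momXn1 j : momcos 0 'X^j = cosmom j.*2 0.
  by rewrite /momcos -['X^j]mulr1 momXn mom1 add0n.
elim: n i => [|n IHn] i.
  rewrite chebPS chebQS /wP /wQ /chebP /chebQ /= !mulr0 mul1r subr0 add0r.
  rewrite mulr1 mul1r -exprSr momXn1 mulr1 mulrBr mulr1 -exprSr momcosB !momXn1.
  rewrite addn0 addn1 doubleS !cosmomS0; split => //.
  by rewrite cosmomSS; field.
have [A _] := IHn (i + odd n)%N; have [_ B] := IHn i.
have [_ B'] := IHn (i + ~~ odd n)%N; have [A0 _] := IHn i; have [A1 _] := IHn i.+1.
split.
  have -> : 'X^i * (wP n.+2 * chebP n.+2) =
     'X^(i + odd n) * (wP n.+1 * chebP n.+1) - 'X^i * (wQ n.+1 * chebQ n.+1).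
    by rewrite chebPS /wP /wQ /= !negbK exprD; ring.
  rewrite momcosB A B /= !negbK.
  have -> : ((i + odd n).*2 + ~~ odd n = (i.*2 + odd n).+1)%N by case: (odd n); lia.
  by rewrite cosmomSS; field.
have -> : 'X^i * (wQ n.+2 * chebQ n.+2) =
   'X^(i + ~~ odd n) * (wQ n.+1 * chebQ n.+1) +
   ('X^i * (wP n.+1 * chebP n.+1) - 'X^(i.+1) * (wP n.+1 * chebP n.+1)).
  by rewrite chebQS /wP /wQ /= !negbK exprD exprS; ring.
rewrite momcosD momcosB B' A0 A1 [odd n.+1]/=.
have -> : ((i + ~~ odd n).*2 + odd n = (i.*2 + ~~ odd n).+1)%N by case: (odd n); lia.
set j := (i.*2 + _)%N; rewrite doubleS !addSn -/j (cosmomSS _ j.+1 n) (cosmomSS _ j n.+1).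
by field.
Qed.

Lemma momcos1 l : momcos l.*2 (1 : {poly R}) = (l == 0%N)%:R.
Proof. by rewrite /momcos mom1; case: l. Qed.

(** Orthogonality of the cosines, as [cheb n.+1] is [cos (2 (n+1) t)]. The three-term recursion
    calls for an induction on two consecutive degrees. *)
Lemma momcos_cheb l n : momcos l.*2 (cheb n.+1) = 2^-1 * (l == n.+1)%:R.
Proof.
pose D m l := momcos l.*2 (cheb m.+1) = 2^-1 * (l == m.+1)%:R.
suff: (forall l, D n l) /\ (forall l, D n.+1 l) by case=> Dn _; apply: Dn.
have step f l1 : momcos l1.*2 ((4%:R * 'X - 2%:R) * f) =
    if l1 is l2.+1 then momcos l2.*2 f + momcos l1.+1.*2 f else 2 * momcos 2 f.
  rewrite mulrBl momcosB -mulrA !momcosMn; case: l1 => [|l1].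
    by rewrite momcosX0; field.
  by rewrite momcosXS; field.
have D0 l1 : D 0%N l1.
  rewrite /D cheb1 momcosB momcosMn -['X]mulr1; case: l1 => [|l1].
    by rewrite momcosX0 (momcos1 0) (momcos1 1) /=; field.
  by rewrite momcosXS !momcos1 /= eqSS; case: l1 => [|l1] /=; field.
elim: n => [|n [IH0 IH1]]; split => // l1.
  rewrite /D chebSS cheb0 momcosB step momcos1.
  case: l1 => [|l1]; first by rewrite (D0 1%N) /=; field.
  by rewrite !D0 /= !eqSS subr0; case: l1 => [|l1] /=; ring.
rewrite /D chebSS momcosB step IH0.
case: l1 => [|l1].
  by rewrite (IH1 1%N) !eqSS mulr0 !mulr0 subr0.
rewrite !IH1 !eqSS.
case: (l1 =P n.+2) => [->|_] /=; last by ring.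
by have -> : (n.+2 == n) = false by [lia]; ring.
Qed.

(** Each step of [chebSS] multiplies the leading coefficient by 4. The nonzero pivot [2 * 4 ^+ n]
    later allows solving for the moment of order [n.+1]. *)
Lemma coef_cheb n : (forall i, (n.+1 < i)%N -> (cheb n.+1)`_i = 0) /\
  (cheb n.+1)`_n.+1 = 2 * 4 ^+ n.
Proof.
pose D m := (forall i, (m.+1 < i)%N -> (cheb m.+1)`_i = 0) /\
  (cheb m.+1)`_m.+1 = 2 * 4 ^+ m.
have coef4 f i : ((4%:R * 'X - 2%:R) * f)`_i.+1 = 4 * f`_i - 2 * f`_i.+1.
  rewrite mulrBl -mulrA (mulr_natl ('X * f)) (mulr_natl f) coefB !coefMn coefXM /=.
  by rewrite (mulr_natl f`_i) (mulr_natl f`_i.+1).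
have step (f g : {poly R}) m a : (forall i, (m.+1 < i)%N -> f`_i = 0) -> f`_m.+1 = a ->
    (forall i, (m.+1 < i)%N -> g`_i = 0) ->
    (forall i, (m.+2 < i)%N -> ((4%:R * 'X - 2%:R) * f - g)`_i = 0) /\
    ((4%:R * 'X - 2%:R) * f - g)`_m.+2 = 4 * a.
  move=> Zf Lf Zg; split=> [[|i] // lt_i|].
    by rewrite coefB coef4 !Zf ?Zg ?mulr0 ?subr0 //; lia.
  by rewrite coefB coef4 Lf Zf // Zg // mulr0 !subr0.
have mulS m : 2 * 4 ^+ m.+1 = 4 * (2 * 4 ^+ m) :> R by rewrite exprS; ring.
have D0 : D 0%N.
  rewrite /D cheb1 mulr_natl.
  by split=> [[|[|i]]|] //; rewrite coefB coefMn coefX coef1 /= ?mul0rn ?subr0 ?expr0 ?mulr1.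
suff: D n /\ D n.+1 by case.
elim: n => [|n [[Z0 L0] [Z1 L1]]].
  split=> //; rewrite /D chebSS cheb0 mulS; have [Z0 L0] := D0.
  by apply: step => // [[|i]] //; rewrite coef1.
split; first by split.
rewrite /D chebSS mulS; apply: step => // i lt_i; apply: Z0.
exact: ltnW.
Qed.

(* Left multiplication by the triangular matrix of the coefficients of the
   orthogonal polynomials [T d] makes the Hankel matrix triangular. *)
Lemma hankel_unit (s : nat -> R^o) c (T : nat -> {poly R}) :
  (forall d, (d < c)%N -> (size (T d) <= d.+1)%N) ->
  (forall d i, (i < d < c)%N -> mom s ('X^i * T d) = 0) ->
  (forall d, (d < c)%N -> mom s ('X^d * T d) != 0) ->
  (\matrix_(i < c, j < c) s (i + j)%N : 'M[R]_c) \in unitmx.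
Proof.
move=> szT T0 Tn0; set H := \matrix_(i, j) _.
pose B : 'M[R]_c := \matrix_(d, j) (T d)`_j.
have BH (d i : 'I_c) : (B *m H) d i = mom s ('X^i * T d).
  rewrite mxE momXn (@mom_wide _ _ _ _ c); last by rewrite (leq_trans (szT d _)).
  by apply: eq_bigr => j _; rewrite !mxE.
have : (B *m H)^T \in unitmx.
  rewrite unitmxE det_trig.
    by rewrite unitfE prodf_seq_neq0; apply/allP => i _; rewrite mxE BH Tn0.
  by apply/is_trig_mxP => i j lt_ij; rewrite mxE BH T0 // lt_ij /=.
by rewrite unitmx_tr unitmx_mul => /andP[].
Qed.

(** A fixed parity [e] fixes the weight [x^e], for which the [chebP (d.*2 + e)] are orthogonal:
    their moments against ['X^i] are [cosmom (i.*2 + e) (d.*2 + e)], zero for [i < d] and positive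
    for [i = d]. *)
Lemma hankelP_unit (e : bool) c :
  (\matrix_(i < c, j < c) cosmom (i + j + e).*2 0 : 'M[R]_c) \in unitmx.
Proof.
pose T d : {poly R} := if (d.*2 + e)%N is n.+1 then chebP n.+1 else 1.
have momT d i : mom (fun i => cosmom (i + e).*2 0 : R^o) ('X^i * T d) =
    cosmom (i.*2 + e) (d.*2 + e).
  rewrite -(@momXn _ R^o (fun i => cosmom i.*2 0)) -/(momcos _ _) mulrCA.
  rewrite /T; case E : (d.*2 + e)%N => [|n].
    have -> : e = false by case: (e) E; lia.
    by rewrite expr0 mul1r /momcos momXn mom1 add0n addn0.
  have odd_e : ~~ odd n = e by rewrite -[~~ _]/(odd n.+1) -E oddD odd_double oddb.
  by have [] := momcos_wPQ n i; rewrite /wP [odd n.+1]/= odd_e.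
apply: (@hankel_unit (fun i => cosmom (i + e).*2 0) c T) => [d _|d i|d _].
- rewrite /T; case E : (d.*2 + e)%N => [|n]; first by rewrite size_poly1.
  by apply: leq_trans (size_chebP n) _; case: (e) E; lia.
- by move=> /andP[lt_id _]; rewrite momT cosmom_small //; lia.
by rewrite momT gt_eqF // cosmom_diag.
Qed.

(** The same argument for the weights [1 - x] and [x (1 - x)], whose orthogonal polynomials are the
    [chebQ] of index [(d.*2 + o).+1]. *)
Lemma hankelQ_unit (o : bool) c :
  (\matrix_(i < c, j < c) (cosmom (i + j + o).*2 0 - cosmom (i + j + o).+1.*2 0) : 'M[R]_c)
    \in unitmx.
Proof.
pose T d : {poly R} := chebQ (d.*2 + o).+1.
have momT d i : mom (fun i => cosmom (i + o).*2 0 - cosmom (i + o).+1.*2 0 : R^o) ('X^i * T d) =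
    2^-1 * (cosmom (i.*2 + o) (d.*2 + o) - cosmom (i.*2 + o) (d.*2 + o).+2).
  have oddo : odd (d.*2 + o) = o by rewrite oddD odd_double oddb.
  have [_] := momcos_wPQ (d.*2 + o) i; rewrite oddo => <-.
  rewrite mom_seqB /wQ /= oddo negbK.
  have -> : 'X^i * ('X^o * (1 - 'X) * chebQ (d.*2 + o).+1) =
    'X^o * ('X^i * T d) - 'X * ('X^o * ('X^i * T d)) by rewrite /T; ring.
  by rewrite momcosB /momcos momX !momXn.
apply: (@hankel_unit (fun i => cosmom (i + o).*2 0 - cosmom (i + o).+1.*2 0) c T)
  => [d _|d i|d _].
- by apply: leq_trans (size_chebQ _) _; case: (o); lia.
- by move=> /andP[lt_id _]; rewrite momT !cosmom_small ?subr0 ?mulr0 //; lia.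
rewrite momT (@cosmom_small _ _ (_).+2) ?ltnS // subr0.
by rewrite mulf_neq0 ?invr_neq0 ?pnatr_eq0 // gt_eqF // cosmom_diag.
Qed.

End ChebyshevMoments.

(** * Square roots over a real closed field *)

Section MatrixSquareRoot.
Variable R : rcfType.
Local Open Scope sesquilinear_scope.

(** A nonzero entry [W i j] forces the [i]-th and [j]-th entries of [d] to agree, hence also their
    images under [f]. *)
Lemma comm_diag_map (F : fieldType) n (W : 'M[F]_n) (d : 'rV[F]_n) (f : F -> F) :
  diag_mx d *m W = W *m diag_mx d ->
  diag_mx (map_mx f d) *m W = W *m diag_mx (map_mx f d).
Proof.
move=> comm; apply/matrixP => i j; move/matrixP/(_ i j): comm.
rewrite !mul_diag_mx !mul_mx_diag !mxE.
have [-> _|Wn0] := eqVneq (W i j) 0; first by rewrite mulr0 mul0r.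
by rewrite mulrC => /(mulfI Wn0) ->; rewrite mulrC.
Qed.

(* Functional calculus: [P^-1 f(D) P] depends only on [P^-1 D P]. *)
Lemma diag_calculus (F : fieldType) n (P Q : 'M[F]_n) (d : 'rV[F]_n) (f : F -> F) :
  P \in unitmx -> Q \in unitmx ->
  invmx P *m diag_mx d *m P = invmx Q *m diag_mx d *m Q ->
  invmx P *m diag_mx (map_mx f d) *m P = invmx Q *m diag_mx (map_mx f d) *m Q.
Proof.
move=> uP uQ eqPQ.
have comm : diag_mx d *m (P *m invmx Q) = P *m invmx Q *m diag_mx d.
  apply: (can_inj (mulKVmx uP)); apply: (can_inj (mulmxK uQ)).
  by rewrite !mulmxA mulVmx // mul1mx mulmxKV.
have := congr1 (fun M => invmx P *m M *m Q) (comm_diag_map f comm).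
by rewrite !mulmxA mulVmx // mul1mx mulmxKV.
Qed.

Local Notation C := (complex R).
Local Notation toC := (map_mx (real_complex R)).

Lemma conj_toC m n (X : 'M[R]_(m, n)) : map_mx Num.conj (toC X) = toC X.
Proof. by apply/matrixP => i j; rewrite !mxE; apply: conjc_real. Qed.

(** The real and imaginary parts of [u] satisfy the same eigenvalue equation for the real matrix,
    and one of them is nonzero; the quadratic form at that vector has the sign of [a]. *)
Lemma real_eigen_ge0 p (X : 'M[R]_p) (u : 'rV[C]_p) (a : R) :
  psd X -> u != 0 -> u *m toC X = a%:C%C *: u -> 0 <= a.
Proof.
move=> [_ X0] un0 uX.
have part (g : C -> R) : (forall (c : C) (r : R), g (c * r%:C%C) = g c * r) ->
    (forall c d, g (c + d) = g c + g d) -> map_mx g u != 0 -> 0 <= a.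
  move=> gM gD gn0.
  have g0 : g 0 = 0 by have := gM 0 0; rewrite mul0r mulr0.
  have gX : map_mx g u *m X = a *: map_mx g u.
    apply/rowP => j; move/rowP/(_ j): uX; rewrite !mxE => /(congr1 g).
    rewrite [in X in _ = X -> _]mulrC gM [a * _]mulrC => <-.
    rewrite (big_morph g gD g0); apply: eq_bigr => i _.
    by rewrite !mxE gM.
  have := X0 (map_mx g u); rewrite gX -scalemxAl mxE.
  rewrite pmulr_lge0 // lt_def; apply/andP; split; last first.
    by rewrite mxE sumr_ge0 // => i _; rewrite [_^T _ _]mxE -expr2 sqr_ge0.
  apply: contraNneq gn0 => sq0; apply/eqP/rowP => j; rewrite mxE [RHS]mxE.
  move: sq0; rewrite mxE => /eqP.
  rewrite psumr_eq0 => [/allP/(_ j)|i _]; last by rewrite [_^T _ _]mxE -expr2 sqr_ge0.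
  by rewrite mem_index_enum [_^T _ _]mxE -expr2 sqrf_eq0 mxE => /(_ isT)/eqP.
have [re0|] := eqVneq (map_mx (@complex.Re R) u) 0; last first.
  by apply: part => [[x y] r|[x y] [z t]] //=; rewrite mulr0 subr0.
have [im0|] := eqVneq (map_mx (@complex.Im R) u) 0; last first.
  by apply: part => [[x y] r|[x y] [z t]] //=; rewrite mulr0 add0r.
case/eqP: un0; apply/rowP => j; rewrite mxE.
move/rowP/(_ j): re0; move/rowP/(_ j): im0; rewrite !mxE.
by case: (u 0 j) => x y /= -> ->.
Qed.

(** Diagonalise over [complex R], take roots of the eigenvalues and descend: the result is real and
    symmetric because conjugation and transposition fix [X] and the functional calculus depends on
    [X] alone. *)
Lemma psd_sqrt p (X : 'M[R]_p) : psd X -> exists Y : 'M[R]_p, psd Y /\ Y *m Y = X.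
Proof.
move=> psdX; have [symX X0] := psdX.
have hermX : toC X \is hermsymmx.
  apply/is_hermitianmxP; rewrite expr0 scale1r; apply/matrixP => i j.
  by rewrite !mxE -{1}symX mxE; apply/esym/conjc_real.
have [P uP [d d_real defX]] : exists2 P : 'M[C]_p, P \in unitmx &
    exists2 d : 'rV[C]_p, (forall i, d 0 i \is Num.real) &
    toC X = invmx P *m diag_mx d *m P.
  exists (spectralmx (toC X)); first exact: spectral_unit.
  exists (spectral_diag (toC X)).
    by move=> i; apply: (mxOverP (hermitian_spectral_diag_real hermX)).
  exact/orthomx_spectralP/hermitian_normalmx.
have d_ge0 i : 0 <= complex.Re (d 0 i).
  apply: (@real_eigen_ge0 _ X (row i P)) => //.
    apply: contraTneq uP => Pi0; rewrite -row_free_unit -kermx_eq0.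
    apply/rowV0Pn; exists (delta_mx 0 i); last first.
      by apply/eqP => /rowP/(_ i)/eqP; rewrite !mxE !eqxx oner_eq0.
    by apply/sub_kermxP; rewrite -rowE.
  rewrite RRe_real // -row_mul defX -!mulmxA mulKVmx // row_mul.
  by rewrite row_diag_mx -scalemxAl -rowE.
(* A fourth root is taken, so that the square root of [X] is itself the square of a symmetric [Z]
   and its nonnegativity is immediate. *)
pose f (z : C) : C := (Num.sqrt (Num.sqrt (complex.Re z)))%:C%C.
pose Zc := invmx P *m diag_mx (map_mx f d) *m P.
have f4 i : f (d 0 i) * f (d 0 i) * (f (d 0 i) * f (d 0 i)) = d 0 i.
  rewrite /f -!rmorphM /= -!expr2 !sqr_sqrtr ?sqrtr_ge0 //.
  by rewrite RRe_real.
have conjZ : map_mx Num.conj Zc = Zc.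
  rewrite /Zc !map_mxM map_invmx map_diag_mx -map_mx_comp.
  have -> : map_mx (Num.conj \o f) d = map_mx f d.
    by apply/rowP => i; rewrite !mxE /= /f; apply: conjc_real.
  apply: diag_calculus => //; first by rewrite map_unitmx.
  rewrite -defX -[RHS]conj_toC defX !map_mxM map_invmx map_diag_mx.
  congr (_ *m diag_mx _ *m _); apply/rowP => i; rewrite mxE; apply/esym/CrealP.
  exact: d_real.
have trZ : Zc^T = Zc.
  rewrite /Zc !trmx_mul tr_diag_mx trmx_inv mulmxA -{1}(invmxK P^T).
  apply: (@diag_calculus _ _ (invmx P^T) P d f); rewrite ?unitmx_inv ?unitmx_tr //.
  rewrite -defX -[in RHS]symX -map_trmx defX !trmx_mul tr_diag_mx trmx_inv.
  by rewrite invmxK mulmxA.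
pose Z := map_mx (@complex.Re R) Zc.
have defZ : toC Z = Zc.
  apply/matrixP => i j; rewrite 2!mxE; apply: RRe_real; apply/CrealP.
  by rewrite -[in RHS]conjZ [RHS]mxE.
have symZ : Z^T = Z by rewrite /Z map_trmx trZ.
exists (Z *m Z); split; last first.
  apply: (@map_mx_inj _ _ (real_complex R)); rewrite !map_mxM defZ defX /Zc.
  rewrite !mulmxA !(mulmxK uP) -!(mulmxA (invmx P)) !mulmx_diag.
  congr (_ *m (diag_mx _ *m _)); apply/rowP => i.
  by rewrite !mxE -[RHS]f4 !mulrA.
split=> [|v]; first by rewrite /sym trmx_mul symZ.
rewrite mulmxA -[X in _ *m X *m _]symZ -mulmxA -trmx_mul mxE sumr_ge0 // => i _.
by rewrite [_^T _ _]mxE -expr2 sqr_ge0.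
Qed.

End MatrixSquareRoot.

(** * Norm and positivity estimates *)

Section MatrixNorm.
Variable R : rcfType.

Lemma mnorm_ge0 m n (A : 'M[R]_(m, n)) : 0 <= mnorm A.
Proof. by apply: sumr_ge0 => i _; apply: sumr_ge0. Qed.

Lemma mnorm0 m n : mnorm (0 : 'M[R]_(m, n)) = 0.
Proof. by apply: big1 => i _; apply: big1 => j _; rewrite mxE normr0. Qed.

Lemma mnormD m n (A B : 'M[R]_(m, n)) : mnorm (A + B) <= mnorm A + mnorm B.
Proof.
rewrite /mnorm -big_split; apply: ler_sum => i _; rewrite -big_split.
by apply: ler_sum => j _; rewrite mxE ler_normD.
Qed.

Lemma mnormZ m n a (A : 'M[R]_(m, n)) : mnorm (a *: A) = `|a| * mnorm A.
Proof.
rewrite /mnorm mulr_sumr; apply: eq_bigr => i _; rewrite mulr_sumr.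
by apply: eq_bigr => j _; rewrite mxE normrM.
Qed.

Lemma mnormN m n (A : 'M[R]_(m, n)) : mnorm (- A) = mnorm A.
Proof. by rewrite -scaleN1r mnormZ normrN1 mul1r. Qed.

Lemma mnormB m n (A B : 'M[R]_(m, n)) : mnorm (A - B) <= mnorm A + mnorm B.
Proof. by rewrite -[mnorm B]mnormN mnormD. Qed.

Lemma mnorm_tr m n (A : 'M[R]_(m, n)) : mnorm A^T = mnorm A.
Proof.
rewrite /mnorm exchange_big; apply: eq_bigr => i _.
by apply: eq_bigr => j _; rewrite mxE.
Qed.

Lemma mnorm_entry m n (A : 'M[R]_(m, n)) i j : `|A i j| <= mnorm A.
Proof.
rewrite /mnorm (bigD1 i) //= (bigD1 j) //= -addrA lerDl.
by rewrite addr_ge0 // ?sumr_ge0 // => k _; rewrite sumr_ge0.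
Qed.

Lemma mnorm_row m n (A : 'M[R]_(m, n)) i : \sum_j `|A i j| <= mnorm A.
Proof.
by rewrite /mnorm (bigD1 i) //= lerDl sumr_ge0 // => k _; rewrite sumr_ge0.
Qed.

Lemma mnorm_le0 m n (A : 'M[R]_(m, n)) : mnorm A <= 0 -> A = 0.
Proof.
move=> A0; apply/matrixP => i j; rewrite mxE; apply/eqP; rewrite -normr_le0.
exact: le_trans (mnorm_entry A i j) A0.
Qed.

Lemma mnormM m n q (A : 'M[R]_(m, n)) (B : 'M[R]_(n, q)) :
  mnorm (A *m B) <= mnorm A * mnorm B.
Proof.
rewrite {1}/mnorm [mnorm A]/mnorm mulr_suml; apply: ler_sum => i _.
rewrite mulr_suml; apply: (@le_trans _ _ (\sum_j \sum_k `|A i k| * `|B k j|)).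
  apply: ler_sum => j _; rewrite mxE; apply: le_trans (ler_norm_sum _ _ _) _.
  by apply: ler_sum => k _; rewrite normrM.
rewrite exchange_big; apply: ler_sum => k _ /=.
by rewrite -mulr_sumr ler_wpM2l // mnorm_row.
Qed.

(* A Neumann-type bound that needs no completeness: both claims come from
   [K0 H = 1 + K0 (H - H0)]. *)
Lemma perturb_inv n (H0 K0 H : 'M[R]_n) : K0 *m H0 = 1%:M ->
  mnorm K0 * mnorm (H - H0) <= 2^-1 ->
  H \in unitmx /\ mnorm (invmx H) <= 2 * mnorm K0.
Proof.
move=> K0H0 small.
have H0K0 : H0 *m K0 = 1%:M by apply: mulmx1C.
have uH : H \in unitmx.
  rewrite -row_free_unit -kermx_eq0; apply/rowV0P => v /sub_kermxP vH.
  have v_eq : v = - (v *m ((H - H0) *m K0)).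
    by rewrite mulmxBl H0K0 mulmxBr mulmx1 mulmxA vH mul0mx sub0r opprK.
  apply: mnorm_le0; have : mnorm v <= mnorm v * 2^-1.
    rewrite {1}v_eq mnormN; apply: le_trans (mnormM _ _) _.
    rewrite ler_wpM2l ?mnorm_ge0 //; apply: le_trans (mnormM _ _) _.
    by rewrite mulrC.
  have := mnorm_ge0 v; lra.
split=> //; set K := invmx H.
have K_eq : K = K0 - K0 *m (H - H0) *m K.
  rewrite mulmxBr mulmxBl K0H0 mul1mx -mulmxA mulmxV // mulmx1.
  by rewrite subKr.
have : mnorm K <= mnorm K0 + 2^-1 * mnorm K.
  rewrite {1}K_eq; apply: le_trans (mnormB _ _) _; rewrite lerD2l.
  apply: le_trans (mnormM _ _) _; rewrite ler_wpM2r ?mnorm_ge0 //.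
  exact: le_trans (mnormM _ _) small.
lra.
Qed.

Lemma rv_sqnorm n (v : 'rV[R]_n) : (v *m v^T) 0 0 = \sum_i v 0 i ^+ 2.
Proof. by rewrite mxE; apply: eq_bigr => i _; rewrite mxE. Qed.

Lemma rv_sqnorm_gt0 n (v : 'rV[R]_n) : v != 0 -> 0 < \sum_i v 0 i ^+ 2.
Proof.
move=> vn0; rewrite lt_def sumr_ge0 ?andbT => [|i _]; last exact: sqr_ge0.
apply: contraNneq vn0 => /eqP; rewrite psumr_eq0 => [/allP v0|i _]; last exact: sqr_ge0.
apply/eqP/rowP => i; rewrite mxE; apply/eqP; rewrite -sqrf_eq0.
exact: v0 (mem_index_enum i).
Qed.

(** The quadratic form is [d |v|^2] plus an error of at most [mnorm E * |v|^2], since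
    [|v_i v_j| <= |v|^2]. *)
Lemma posdef_near n (X : 'M[R]_n) d : sym X -> mnorm (X - d *: 1%:M) < d -> posdef X.
Proof.
move=> symX lt_d; split=> // v vn0; set E := X - _ in lt_d.
have -> : X = d *: 1%:M + E by rewrite addrC subrK.
have sq_gt0 := rv_sqnorm_gt0 vn0; set s := \sum_i _ in sq_gt0.
have vE : `|(v *m E *m v^T) 0 0| <= mnorm E * s.
  rewrite mxE; under eq_bigr => j _ do rewrite [_^T _ _]mxE mxE mulr_suml.
  apply: le_trans (ler_norm_sum _ _ _) _; rewrite /mnorm exchange_big mulr_suml.
  apply: ler_sum => j _; apply: le_trans (ler_norm_sum _ _ _) _.
  rewrite mulr_suml; apply: ler_sum => i _.
  have le_s k : v 0 k ^+ 2 <= s.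
    by rewrite /s (bigD1 k) //= lerDl sumr_ge0 // => l _; apply: sqr_ge0.
  have -> : v 0 i * E i j * v 0 j = E i j * (v 0 i * v 0 j) by ring.
  rewrite normrM ler_wpM2l //; have := le_s i; have := le_s j.
  by rewrite ler_norml; nra.
rewrite mulmxDr mulmxDl mxE -scalemxAr mulmx1 -scalemxAl mxE rv_sqnorm -/s.
move: vE; rewrite ler_norml; nra.
Qed.

Lemma posdef_psd n (X : 'M[R]_n) : posdef X -> psd X.
Proof.
move=> [symX X0]; split=> // v; have [->|vn0] := eqVneq v 0.
  by rewrite !mul0mx mxE.
exact/ltW/X0.
Qed.

Lemma posdef_unit n (X : 'M[R]_n) : posdef X -> X \in unitmx.
Proof.
move=> [_ X0]; rewrite -row_free_unit -kermx_eq0; apply/rowV0P => v /sub_kermxP vX.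
by apply/eqP; apply: contraT => /X0; rewrite vX mul0mx mxE ltxx.
Qed.

Lemma posdefD n (X Y : 'M[R]_n) : posdef X -> posdef Y -> posdef (X + Y).
Proof.
move=> [sX pX] [sY pY]; split; first by rewrite /sym linearD /= sX sY.
by move=> v vn0; rewrite mulmxDr mulmxDl mxE addr_gt0 ?pX ?pY.
Qed.

Lemma msqrtP n (X : 'M[R]_n) : psd X -> psd (msqrt X) /\ msqrt X *m msqrt X = X.
Proof.
move=> /psd_sqrt exY; rewrite /msqrt.
exact: (ClassicalEpsilon.epsilon_spec (inhabits 0) (fun Y => psd Y /\ Y *m Y = X) exY).
Qed.

Lemma msqrt_unit n (X : 'M[R]_n) : posdef X -> msqrt X \in unitmx.
Proof.
move=> pX; have [_ sq] := msqrtP (posdef_psd pX).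
by have := posdef_unit pX; rewrite -{1}sq unitmx_mul => /andP[].
Qed.

(* Row by row, [r (Y + d) r^T >= d |r|^2] for a row [r] of [Y - d], while
   [(Y - d) (Y + d) = Y^2 - d^2]. *)
Lemma psd_sqrt_near n (Y : 'M[R]_n) d : psd Y -> 0 < d ->
  mnorm (Y - d *: 1%:M) <= (n * n)%:R / d * mnorm (Y *m Y - (d * d) *: 1%:M).
Proof.
move=> [symY Y0] d_gt0; set E := Y - _; set G := Y *m Y - _.
have EY : E *m (Y + d *: 1%:M) = G.
  rewrite /E /G mulmxBl !mulmxDr -!scalemxAl -!scalemxAr !mul1mx mulmx1 scalerA.
  by rewrite opprD addrA addrK.
have entry i j : `|E i j| <= mnorm G / d.
  pose r := row i E; pose q := row i G.
  have rq : (r *m (Y + d *: 1%:M) *m r^T) 0 0 = \sum_j q 0 j * r 0 j.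
    rewrite /r -row_mul EY mxE; apply: eq_bigr => k _.
    by congr (_ * _); rewrite mxE.
  have le_rq : d * (\sum_j r 0 j ^+ 2) <= \sum_j q 0 j * r 0 j.
    rewrite -rq mulmxDr mulmxDl mxE -scalemxAr mulmx1 -scalemxAl [X in _ + X]mxE rv_sqnorm.
    by rewrite lerDr Y0.
  have le_d2 : d * d * (\sum_j r 0 j ^+ 2) <= \sum_j q 0 j ^+ 2.
    have : \sum_j 2 * (d * (q 0 j * r 0 j)) <= \sum_j (q 0 j ^+ 2 + d * d * r 0 j ^+ 2).
      apply: ler_sum => k _; have := sqr_ge0 (q 0 k - d * r 0 k); nra.
    rewrite big_split -!mulr_sumr /=; nra.
  have le_q : \sum_j q 0 j ^+ 2 <= mnorm G ^+ 2.
    apply: (@le_trans _ _ (\sum_j `|q 0 j| * mnorm G)).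
      apply: ler_sum => k _; rewrite -real_normK ?num_real // expr2 ler_wpM2l //.
      by rewrite /q mxE mnorm_entry.
    rewrite -mulr_suml expr2 ler_wpM2r ?mnorm_ge0 //.
    by apply: le_trans (mnorm_row G i); apply: ler_sum => k _; rewrite mxE.
  have le_r : r 0 j ^+ 2 <= \sum_j r 0 j ^+ 2.
    by rewrite (bigD1 j) //= lerDl sumr_ge0 // => k _; apply: sqr_ge0.
  have -> : E i j = r 0 j by rewrite [RHS]mxE.
  rewrite ler_pdivlMr // -ler_sqr ?nnegrE ?mulr_ge0 ?mnorm_ge0 ?(ltW d_gt0) //.
  by rewrite exprMn real_normK ?num_real // [d ^+ 2]expr2; nra.
apply: (@le_trans _ _ (\sum_(i < n) \sum_(j < n) mnorm G / d)).
  by apply: ler_sum => i _; apply: ler_sum => j _.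
by rewrite !sumr_const !card_ord -mulrnA -[leLHS]mulr_natl mulrA [leRHS]mulrAC.
Qed.

End MatrixNorm.

(** * Block matrices and Schur complements *)

Section BlockMatrices.
Variables (R : rcfType) (p : nat).
Implicit Types (m n q : nat).

Lemma bidx_subproof m (i : 'I_m) (a : 'I_p) : (i * p + a < m * p)%N.
Proof.
by rewrite (@leq_trans (i.+1 * p)) ?leq_mul2r ?ltn_ord ?orbT // mulSn addnC ltn_add2r.
Qed.
(** Row [a] of block [i]; this inverts the division with remainder by which [blockmx] and [blockcol]
    find their entries. *)
Definition bidx m (i : 'I_m) (a : 'I_p) : 'I_(m * p) := Ordinal (bidx_subproof i a).

Lemma bidx_div m (i : 'I_m) (a : 'I_p) : (bidx i a %/ p)%N = i.
Proof. by rewrite /= divnMDl ?divn_small ?addn0 //; case: a => a; case: p. Qed.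

Lemma bidx_mod m (i : 'I_m) (a : 'I_p) : (bidx i a %% p)%N = a.
Proof. by rewrite /= modnMDl modn_small. Qed.

Lemma bidxP m (r : 'I_(m * p)) : exists i a, r = bidx i a :> 'I_(m * p).
Proof.
have p_gt0 : (0 < p)%N by case: p r => // -[r]; rewrite muln0.
have lt_i : (r %/ p < m)%N by rewrite ltn_divLR.
exists (Ordinal lt_i), (Ordinal (ltn_pmod r p_gt0)).
by apply: val_inj; rewrite /= -divn_eq.
Qed.

Lemma big_bidx m (V : nmodType) (F : 'I_(m * p) -> V) :
  \sum_r F r = \sum_(i < m) \sum_(a < p) F (bidx i a).
Proof.
rewrite pair_big /= (reindex (fun ia : 'I_m * 'I_p => bidx ia.1 ia.2)) //=.
apply: onW_bij; apply: inj_card_bij => [[i a] [j b] /= eq_r|].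
  have := bidx_div i a; have := bidx_mod i a; rewrite eq_r bidx_div bidx_mod.
  by move=> /val_inj -> /val_inj ->.
by rewrite card_prod !card_ord.
Qed.

Lemma ent_ord m n (M : 'M[R]_(m, n)) (i : 'I_m) (j : 'I_n) : ent M i j = M i j.
Proof. by rewrite /ent !valK. Qed.

Lemma blockmxE m n (B : nat -> nat -> 'M[R]_p) (i : 'I_m) a (j : 'I_n) b :
  blockmx m n B (bidx i a) (bidx j b) = B i j a b.
Proof. by rewrite mxE !bidx_div !bidx_mod ent_ord. Qed.

Lemma blockcolE m (B : nat -> 'M[R]_p) (i : 'I_m) a b :
  blockcol m B (bidx i a) b = B i a b.
Proof. by rewrite mxE bidx_div bidx_mod ent_ord. Qed.

Lemma blkE k (M : 'M[R]_(k * p, p)) (i : 'I_k) a b : blk M i a b = M (bidx i a) b.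
Proof. by rewrite mxE -[(i * p + a)%N]/(val (bidx i a)) ent_ord. Qed.

Lemma blockmx_eqP m n (M N : 'M[R]_(m * p, n * p)) :
  (forall i a j b, M (bidx i a) (bidx j b) = N (bidx i a) (bidx j b)) -> M = N.
Proof.
move=> eqMN; apply/matrixP => r c.
by have [i [a ->]] := bidxP r; have [j [b ->]] := bidxP c.
Qed.

Lemma blockcol_eqP m (M N : 'M[R]_(m * p, p)) :
  (forall i a b, M (bidx i a) b = N (bidx i a) b) -> M = N.
Proof. by move=> eqMN; apply/matrixP => r b; have [i [a ->]] := bidxP r. Qed.

Lemma eq_blockcol m (B1 B2 : nat -> 'M[R]_p) :
  (forall i, (i < m)%N -> B1 i = B2 i) -> blockcol m B1 = blockcol m B2.
Proof. by move=> eqB; apply: blockcol_eqP => i a b; rewrite !blockcolE eqB. Qed.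

Lemma eq_blockmx m n (B1 B2 : nat -> nat -> 'M[R]_p) :
  (forall i j, (i < m)%N -> (j < n)%N -> B1 i j = B2 i j) ->
  blockmx m n B1 = blockmx m n B2.
Proof. by move=> eqB; apply: blockmx_eqP => i a j b; rewrite !blockmxE eqB. Qed.

Lemma blk_blockcol k (B : nat -> 'M[R]_p) j : (j < k)%N -> blk (blockcol k B) j = B j.
Proof.
move=> lt_jk; rewrite -[j]/(val (Ordinal lt_jk)).
by apply/matrixP => a b; rewrite blkE blockcolE.
Qed.

Lemma blockcol_blk k (M : 'M[R]_(k * p, p)) : blockcol k (blk M) = M.
Proof. by apply: blockcol_eqP => i a b; rewrite blockcolE blkE. Qed.

Lemma blkD k (M N : 'M[R]_(k * p, p)) j : (j < k)%N ->
  blk (M + N) j = blk M j + blk N j.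
Proof.
move=> lt_jk; rewrite -[j]/(val (Ordinal lt_jk)).
by apply/matrixP => a b; rewrite [RHS]mxE !blkE mxE.
Qed.

Lemma mulmx_blockmx m n q A B :
  blockmx m n A *m blockmx n q B =
  blockmx m q (fun i j => \sum_(l < n) A i l *m B l j) :> 'M[R]_(m * p, q * p).
Proof.
apply: blockmx_eqP => i a j b; rewrite blockmxE mxE big_bidx summxE.
apply: eq_bigr => l _; rewrite mxE; apply: eq_bigr => c _.
by rewrite !blockmxE.
Qed.

Lemma mulmx_blockcol m n A B :
  blockmx m n A *m blockcol n B =
  blockcol m (fun i => \sum_(l < n) A i l *m B l) :> 'M[R]_(m * p, p).
Proof.
apply: blockcol_eqP => i a b; rewrite blockcolE mxE big_bidx summxE.
apply: eq_bigr => l _; rewrite mxE; apply: eq_bigr => c _.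
by rewrite blockmxE blockcolE.
Qed.

Lemma tr_blockcol_mul m A B :
  (blockcol m A)^T *m blockcol m B = \sum_(l < m) (A l)^T *m B l :> 'M[R]_p.
Proof.
apply/matrixP => a b; rewrite mxE big_bidx summxE.
apply: eq_bigr => l _; rewrite mxE; apply: eq_bigr => c _.
by rewrite mxE !blockcolE mxE.
Qed.

Lemma tr_blockmx m n B :
  (blockmx m n B)^T = blockmx n m (fun i j => (B j i)^T) :> 'M[R]_(n * p, m * p).
Proof. by apply: blockmx_eqP => i a j b; rewrite mxE !blockmxE mxE. Qed.

Lemma blockmxB m n A B :
  blockmx m n A - blockmx m n B = blockmx m n (fun i j => A i j - B i j) :> 'M[R]_(m * p, n * p).
Proof. by apply: blockmx_eqP => i a j b; rewrite [LHS]mxE [X in _ + X]mxE !blockmxE !mxE. Qed.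

Lemma blockcolB m A B :
  blockcol m A - blockcol m B = blockcol m (fun i => A i - B i) :> 'M[R]_(m * p, p).
Proof. by apply: blockcol_eqP => i a b; rewrite [LHS]mxE [X in _ + X]mxE !blockcolE !mxE. Qed.

Lemma mnorm_blockcol m B : mnorm (blockcol m B : 'M[R]_(m * p, p)) = \sum_(i < m) mnorm (B i).
Proof.
rewrite /mnorm big_bidx; apply: eq_bigr => i _; apply: eq_bigr => a _.
by apply: eq_bigr => b _; rewrite blockcolE.
Qed.

Lemma mnorm_blockmx m n B :
  mnorm (blockmx m n B : 'M[R]_(m * p, n * p)) = \sum_(i < m) \sum_(j < n) mnorm (B i j).
Proof.
rewrite /mnorm big_bidx; apply: eq_bigr => i _; rewrite exchange_big /= big_bidx.
apply: eq_bigr => j _; rewrite exchange_big /=; apply: eq_bigr => a _.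
by apply: eq_bigr => b _; rewrite blockmxE.
Qed.

Lemma blockmx_scalar_inv m (A : 'M[R]_m) (s : nat -> nat -> R) :
  A \in unitmx -> (forall i j : 'I_m, A i j = s i j) ->
  exists K : 'M[R]_(m * p), K *m blockmx m m (fun i j => s i j *: 1%:M) = 1%:M.
Proof.
move=> uA As; exists (blockmx m m (fun i j => ent (invmx A) i j *: 1%:M)).
rewrite mulmx_blockmx; apply: blockmx_eqP => i a j b; rewrite blockmxE summxE.
transitivity ((invmx A *m A) i j * (a == b)%:R).
  rewrite mxE mulr_suml; apply: eq_bigr => l _.
  by rewrite -scalemxAl mul1mx ent_ord -As !mxE mulrA.
rewrite mulVmx // !mxE -natrM mulnb; congr (_%:R); congr (nat_of_bool _).
apply/andP/eqP => [[/eqP-> /eqP->] //|eq_r].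
have := bidx_div i a; have := bidx_mod i a; rewrite eq_r bidx_div bidx_mod.
by move=> /val_inj -> /val_inj ->.
Qed.

End BlockMatrices.

(** * Expansion of the moment bounds along orthogonal polynomials *)

Section SchurExpansion.
Variables (R : rcfType) (p : nat).
Implicit Types (W S : nat -> 'M[R]_p) (f : {poly R}) (c n : nat).

Definition hankel W c : 'M[R]_(c * p) := blockmx c c (fun i j => W (i + j)%N).
(** What is subtracted from the corner [W (c + c)] in the Schur complement of [hankel W c] inside
    [hankel W c.+1]. *)
Definition schur W c : 'M[R]_p :=
  let h := blockcol c (fun i => W (c + i)%N) in h^T *m invmx (hankel W c) *m h.
Definition residual W c f : 'M[R]_(c * p, p) := blockcol c (fun i => mom W ('X^i * f)).
Definition schur_error W c f : 'M[R]_p :=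
  (residual W c f)^T *m invmx (hankel W c) *m residual W c f.

Lemma mom_trmx W f : (forall i, sym (W i)) -> (mom W f)^T = mom W f.
Proof. by move=> symW; rewrite linear_sum; apply: eq_bigr => i _; rewrite linearZ /= symW. Qed.

Lemma hankel_tr W c : (forall i, sym (W i)) -> (hankel W c)^T = hankel W c.
Proof.
by move=> symW; rewrite tr_blockmx; apply: eq_blockmx => i j _ _; rewrite addnC symW.
Qed.

(* Completing the square: the Schur complement is, up to a quadratic error, the
   value that the monic polynomial [f] assigns to it, whichever [f] is used. *)
Lemma schur_expand W c f : (forall i, sym (W i)) -> (size f <= c.+1)%N -> f`_c = 1 ->
  hankel W c \in unitmx ->
  schur W c = W (c + c)%N - mom W (f * f) + schur_error W c f.
Proof.
move=> symW szf fc uH; rewrite /schur /schur_error.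
set h := blockcol c _; set H := hankel W c in uH *; set y := residual W c f.
(* The lower coefficients of [f]. As [f] is monic, [y = h + H X], which eliminates [h]. *)
pose X : 'M[R]_(c * p, p) := blockcol c (fun j => f`_j *: 1%:M).
have momXf i : mom W ('X^i * f) = \sum_(j < c) f`_j *: W (i + j)%N + W (c + i)%N.
  rewrite momXn (mom_wide _ szf) big_ord_recr /= fc scale1r; congr (_ + _).
  by apply: eq_bigr => j _; rewrite addnC.
have h_eq : h = y - H *m X.
  rewrite mulmx_blockcol blockcolB; apply: eq_blockcol => i lt_ic.
  rewrite momXf; apply/eqP; rewrite eq_sym subr_eq [eqbRHS]addrC; apply/eqP.
  by congr (_ + _); apply: eq_bigr => j _; rewrite -scalemxAr mulmx1.
have XT B : X^T *m blockcol c B = \sum_(i < c) f`_i *: B i.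
  rewrite tr_blockcol_mul; apply: eq_bigr => i _.
  by rewrite linearZ /= trmx1 -scalemxAl mul1mx.
have Xy : X^T *m y = y^T *m X.
  rewrite -[RHS]trmxK trmx_mul trmxK -[LHS]trmxK; congr (_^T).
  rewrite XT linear_sum; apply: eq_bigr => i _.
  by rewrite linearZ /= mom_trmx.
have ff : mom W (f * f) = X^T *m y + X^T *m h + W (c + c)%N.
  rewrite momMl !XT.
  have -> : \sum_(i < size f) f`_i *: mom W ('X^i * f) =
            \sum_(i < c.+1) f`_i *: mom W ('X^i * f).
    rewrite (big_ord_widen_cond c.+1 xpredT (fun i => f`_i *: mom W ('X^i * f))) //.
    rewrite big_mkcond /=; apply: eq_bigr => i _; case: ltnP => // le_fi.
    by rewrite nth_default // scale0r.
  by rewrite big_ord_recr /= fc scale1r (momXf c) addrA.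
have hT : h^T = y^T - X^T *m H.
  by rewrite h_eq linearB /= trmx_mul hankel_tr.
(* Once [h] is replaced by [y - H X], only [y^T H^-1 y], [y^T X], [X^T H X] and the corner moment
   remain, and their coefficients agree. *)
rewrite ff hT h_eq !mulmxBl !mulmxBr -!(mulmxA _ (invmx H)) !(mulKmx uH) !mulmxA mulmxK //.
rewrite Xy; set a := y^T *m _ *m y; set b := y^T *m X; set d := X^T *m H *m X.
by apply/eqP; rewrite -subr_eq0; apply/eqP/matrixP => i j; rewrite !mxE; ring.
Qed.

(** If [S] comes from a measure, this sequence and the next are the moments of that measure times
    [x^(~~ odd n)] and [x^(odd n) (1 - x)], the weights [wP n.+1] and [wQ n.+1]; one Hankel form
    thus covers both parities. *)
Definition minusW S n i := S (i + ~~ odd n)%N.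
Definition plusW S n i := S (i + odd n)%N - S (i + odd n).+1.
Definition chebPmonic n : {poly R} := 2 ^- n *: chebP R n.+1.
Definition chebQmonic n : {poly R} := 2 ^- n *: chebQ R n.+1.
Definition minus_error S n := schur_error (minusW S n) (uphalf n) (chebPmonic n).
Definition plus_error S n := schur_error (plusW S n) n./2 (chebQmonic n).

Lemma Sminus_schur S n : Sminus_step S n = schur (minusW S n) (uphalf n).
Proof.
have eq_h : blockcol (uphalf n) (fun i => S (n./2 + 1 + i)%N) =
            blockcol (uphalf n) (fun i => minusW S n (uphalf n + i)).
  apply: eq_blockcol => i _; congr (S _); rewrite uphalf_half.
  by case: (odd n) => /=; lia.
by rewrite /Sminus_step /schur eq_h.
Qed.

Lemma Splus_schur S n : Splus_step S n = S n - schur (plusW S n) n./2.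
Proof.
have eq_h : blockcol n./2 (fun i => S (uphalf n + i)%N - S (uphalf n + i + 1)%N) =
            blockcol n./2 (fun i => plusW S n (n./2 + i)).
  apply: eq_blockcol => i _; congr (S _ - S _); rewrite uphalf_half;
    by case: (odd n) => /=; lia.
have eq_H : blockmx n./2 n./2 (fun i j => S (i + j + odd n)%N - S (i + j + odd n + 1)%N) =
            hankel (plusW S n) n./2.
  by apply: eq_blockmx => i j _ _; rewrite addn1.
by rewrite /Splus_step /schur eq_h eq_H.
Qed.

Lemma half_parity n : (uphalf n + uphalf n + ~~ odd n = n.+1)%N /\ (n./2 + n./2 + odd n = n)%N.
Proof. by have := odd_double_half n; rewrite uphalf_half; case: (odd n) => /=; lia. Qed.

Lemma scale_sqr f n : (2 ^- n *: f) * (2 ^- n *: f) = 4 ^- n *: f ^+ 2.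
Proof. by rewrite -scalerAl -scalerAr scalerA -invfM -exprMn -natrM -expr2. Qed.

Lemma mom_minusW S n f : mom (minusW S n) f = mom S (wP R n.+1 * f).
Proof. by rewrite momXn. Qed.

Lemma mom_wQ (V : lmodType R) (s : nat -> V) n f :
  mom (fun i => s (i + odd n)%N - s (i + odd n).+1) f = mom s (wQ R n.+1 * f).
Proof.
rewrite /wQ /= negbK; have -> : 'X^(odd n) * (1 - 'X) * f =
  'X^(odd n) * f - 'X * ('X^(odd n) * f) by ring.
by rewrite momB momX !momXn -mom_seqB.
Qed.

(** The corner moment [W (c + c)] is [S n.+1] by [half_parity]; the scale [4 ^- n] comes from making
    both factors monic. *)
Lemma Sminus_expand S n : (forall i, sym (S i)) ->
  hankel (minusW S n) (uphalf n) \in unitmx ->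
  Sminus_step S n = S n.+1 - 4 ^- n *: mom S (wP R n.+1 * chebP R n.+1 ^+ 2)
    + minus_error S n.
Proof.
move=> symS uH; have [_ lead _ _] := chebPQ_lead R n.
rewrite Sminus_schur (schur_expand (f := chebPmonic n)) //; first last.
- by rewrite coefZ lead mulVf // expf_neq0 // pnatr_eq0.
- by rewrite (leq_trans (size_scale_leq _ _)) // size_chebP.
- by move=> i; apply: symS.
rewrite /minusW (half_parity n).1 -/(minusW S n) mom_minusW.
by rewrite scale_sqr -scalerAr momZ.
Qed.

(** Here the corner is [S n - S n.+1], so [S n] cancels and [S n.+1] survives with a plus sign. *)
Lemma Splus_expand S n : (forall i, sym (S i)) ->
  hankel (plusW S n) n./2 \in unitmx ->
  Splus_step S n = S n.+1 + 4 ^- n *: mom S (wQ R n.+1 * chebQ R n.+1 ^+ 2)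
    - plus_error S n.
Proof.
move=> symS uH; have [_ _ _ lead] := chebPQ_lead R n.
rewrite Splus_schur (schur_expand (f := chebQmonic n)) //; first last.
- by rewrite coefZ lead mulVf // expf_neq0 // pnatr_eq0.
- by rewrite (leq_trans (size_scale_leq _ _)) // size_chebQ.
- by move=> i; rewrite /sym linearB /= !symS.
rewrite {1}/plusW (half_parity n).2 mom_wQ.
rewrite scale_sqr -scalerAr momZ.
by rewrite !opprD !opprK !addrA subrr add0r.
Qed.

(** The terms [S n.+1] cancel, and the two weighted squares add up to the constant 1 by
    [cheb_pell]. *)
Lemma S_range S n : (forall i, sym (S i)) -> S 0%N = 1%:M ->
  hankel (minusW S n) (uphalf n) \in unitmx -> hankel (plusW S n) n./2 \in unitmx ->
  Splus_step S n - Sminus_step S n = 4 ^- n *: 1%:M - (plus_error S n + minus_error S n).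
Proof.
move=> symS S0 uP uQ; rewrite Sminus_expand // Splus_expand // -S0 -mom1 -(cheb_pell R n.+1) momD.
by rewrite scalerDr; apply/matrixP => i j; rewrite !mxE; ring.
Qed.

(** The left-hand side is the moment that a canonical moment of one half selects; the weighted
    squares now enter through their difference, [cheb R n.+1]. *)
Lemma S_center S n : (forall i, sym (S i)) ->
  hankel (minusW S n) (uphalf n) \in unitmx -> hankel (plusW S n) n./2 \in unitmx ->
  Sminus_step S n + 2^-1 *: (Splus_step S n - Sminus_step S n) =
  S n.+1 - (2 * 4 ^+ n)^-1 *: mom S (cheb R n.+1) + 2^-1 *: (minus_error S n - plus_error S n).
Proof.
move=> symS uP uQ; rewrite Sminus_expand // Splus_expand // /cheb momB invfM.
by apply/matrixP => i j; rewrite !mxE; field; rewrite expf_neq0 // pnatr_eq0.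
Qed.

End SchurExpansion.

(** * First-order asymptotics at the origin *)

Section Asymptotics.
Variables (R : rcfType) (p k : nat).
Local Notation X := 'M[R]_(k * p, p).
Implicit Types (P Q : X -> Prop).

(** Neighbourhoods of 0 within the symmetric block columns, the directions over which [mx_diff_at]
    quantifies. *)
Definition near0 P := exists2 delta : R, 0 < delta &
  forall H, symblocks H -> mnorm H < delta -> P H.

Lemma near0_and P Q : near0 P -> near0 Q -> near0 (fun H => P H /\ Q H).
Proof.
move=> [d1 d1_gt0 P1] [d2 d2_gt0 Q2]; exists (Num.min d1 d2).
  by rewrite lt_min d1_gt0.
by move=> H symH; rewrite lt_min => /andP[lt1 lt2]; split; [apply: P1 | apply: Q2].
Qed.

Lemma near0_imp P Q : near0 P -> (forall H, symblocks H -> P H -> Q H) -> near0 Q.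
Proof. by move=> [d d_gt0 Pd] PQ; exists d => // H symH /(Pd H symH)/(PQ H symH). Qed.

Lemma near0_imp2 P1 P2 Q : near0 P1 -> near0 P2 ->
  (forall H, symblocks H -> P1 H -> P2 H -> Q H) -> near0 Q.
Proof. by move=> N1 N2 PQ; apply: near0_imp (near0_and N1 N2) _ => H sH []; apply: PQ. Qed.

Lemma near0_all P : (forall H, symblocks H -> P H) -> near0 P.
Proof. by move=> allP; exists 1 => // H symH _; apply: allP. Qed.

Lemma near0_ltn N (P : nat -> X -> Prop) : (forall i, (i < N)%N -> near0 (P i)) ->
  near0 (fun H => forall i, (i < N)%N -> P i H).
Proof.
elim: N => [|N IHN] nP; first exact: near0_all.
apply: near0_imp2 (IHN _) (nP N (ltnSn N)) _ => [i lt_i|H symH P1 P2 i].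
  exact/nP/ltnW.
by rewrite ltnS leq_eqVlt => /orP[/eqP->|/P1].
Qed.

Section Sizes.
Variables m n : nat.
Implicit Types f g : X -> 'M[R]_(m, n).

Definition bounded f := exists2 C, 0 <= C & near0 (fun H => mnorm (f H) <= C).
Definition bigO f := exists2 C, 0 <= C & near0 (fun H => mnorm (f H) <= C * mnorm H).
Definition littleo f := forall e, 0 < e -> near0 (fun H => mnorm (f H) <= e * mnorm H).

Lemma littleo_bigO f : littleo f -> bigO f.
Proof. by move=> /(_ 1 ltr01) f1; exists 1. Qed.

Lemma bigO_small f e : bigO f -> 0 < e -> near0 (fun H => mnorm (f H) < e).
Proof.
move=> [C C_ge0 [d d_gt0 fC]] e_gt0; have C1_gt0 : 0 < C + 1 by lra.
(* The [+ 1] keeps the radius positive when [C = 0]. *)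
exists (Num.min d (e / (C + 1))); first by rewrite lt_min d_gt0 divr_gt0.
move=> H symH; rewrite lt_min ltr_pdivlMr // => /andP[lt1 lt2].
apply: le_lt_trans (fC H symH lt1) _; have := mnorm_ge0 H; nra.
Qed.

Lemma bigO_bounded f (A : 'M[R]_(m, n)) : bigO (fun H => f H - A) -> bounded f.
Proof.
move=> /bigO_small/(_ ltr01) near_A; exists (1 + mnorm A).
  by rewrite addr_ge0 ?mnorm_ge0.
apply: near0_imp near_A _ => H _ lt1; rewrite -[f H](subrK A).
by apply: le_trans (mnormD _ _) _; rewrite lerD2r ltW.
Qed.

Lemma bigO_near f g : near0 (fun H => f H = g H) -> bigO g -> bigO f.
Proof.
move=> eqfg [C C_ge0 gC]; exists C => //.
by apply: near0_imp2 eqfg gC _ => H _ ->.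
Qed.

Lemma littleo_near f g : near0 (fun H => f H = g H) -> littleo g -> littleo f.
Proof. by move=> eqfg g0 e /g0 ge; apply: near0_imp2 eqfg ge _ => H _ ->. Qed.

Lemma bigO0 : bigO (fun _ => 0).
Proof. by exists 0 => //; apply: near0_all => H _; rewrite mnorm0 mul0r. Qed.

Lemma littleo0 : littleo (fun _ => 0).
Proof.
by move=> e e_gt0; apply: near0_all => H _; rewrite mnorm0 mulr_ge0 ?mnorm_ge0 ?ltW.
Qed.

Lemma bigOD f g : bigO f -> bigO g -> bigO (fun H => f H + g H).
Proof.
move=> [C C_ge0 fC] [D D_ge0 gD]; exists (C + D); first exact: addr_ge0.
apply: near0_imp2 fC gD _ => H _ fH gH; apply: le_trans (mnormD _ _) _.
by rewrite mulrDl lerD.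
Qed.

Lemma littleoD f g : littleo f -> littleo g -> littleo (fun H => f H + g H).
Proof.
move=> f0 g0 e e_gt0; have e2_gt0 : 0 < e / 2 by rewrite divr_gt0.
apply: near0_imp2 (f0 _ e2_gt0) (g0 _ e2_gt0) _ => H _ fH gH.
apply: le_trans (mnormD _ _) _; lra.
Qed.

Lemma bigOZ a f : bigO f -> bigO (fun H => a *: f H).
Proof.
move=> [C C_ge0 fC]; exists (`|a| * C); first exact: mulr_ge0.
by apply: near0_imp fC _ => H _ fH; rewrite mnormZ -mulrA ler_wpM2l.
Qed.

Lemma littleoZ a f : littleo f -> littleo (fun H => a *: f H).
Proof.
move=> f0 e e_gt0; have a1_gt0 : 0 < `|a| + 1 by rewrite ltr_wpDl.
have := f0 (e / (`|a| + 1)); rewrite divr_gt0 // => /(_ isT) fe.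
apply: near0_imp fe _ => H _ fH; rewrite mnormZ.
apply: (@le_trans _ _ ((`|a| + 1) * mnorm (f H))).
  by rewrite ler_wpM2r ?mnorm_ge0 // lerDl.
by apply: le_trans (ler_wpM2l (ltW a1_gt0) fH) _; rewrite mulrA mulrCA divff ?mulr1 // gt_eqF.
Qed.

Lemma bigOB f g : bigO f -> bigO g -> bigO (fun H => f H - g H).
Proof.
move=> fO gO; apply: bigO_near (bigOD fO (bigOZ (-1) gO)).
by apply: near0_all => H _; rewrite scaleN1r.
Qed.

Lemma littleoB f g : littleo f -> littleo g -> littleo (fun H => f H - g H).
Proof.
move=> fO gO; apply: littleo_near (littleoD fO (littleoZ (-1) gO)).
by apply: near0_all => H _; rewrite scaleN1r.
Qed.

Lemma bigO_sum N (F : nat -> X -> 'M[R]_(m, n)) :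
  (forall i, (i < N)%N -> bigO (F i)) -> bigO (fun H => \sum_(i < N) F i H).
Proof.
elim: N => [|N IHN] FO.
  by apply: bigO_near bigO0; apply: near0_all => H _; rewrite big_ord0.
apply: bigO_near (bigOD (IHN _) (FO N (ltnSn N))) => [|i lt_i].
  by apply: near0_all => H _; rewrite big_ord_recr.
exact/FO/ltnW.
Qed.

Lemma littleo_sum N (F : nat -> X -> 'M[R]_(m, n)) :
  (forall i, (i < N)%N -> littleo (F i)) -> littleo (fun H => \sum_(i < N) F i H).
Proof.
elim: N => [|N IHN] FO.
  by apply: littleo_near littleo0; apply: near0_all => H _; rewrite big_ord0.
apply: littleo_near (littleoD (IHN _) (FO N (ltnSn N))) => [|i lt_i].
  by apply: near0_all => H _; rewrite big_ord_recr.
exact/FO/ltnW.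
Qed.

End Sizes.

Lemma bigO_tr m n (f : X -> 'M[R]_(m, n)) : bigO f -> bigO (fun H => (f H)^T).
Proof. by move=> [C C0 fC]; exists C => //; apply: near0_imp fC _ => H _; rewrite mnorm_tr. Qed.

Lemma bigO_mulr m n q (f : X -> 'M[R]_(m, n)) (g : X -> 'M[R]_(n, q)) :
  bigO f -> bounded g -> bigO (fun H => f H *m g H).
Proof.
move=> [C C_ge0 fC] [D D_ge0 gD]; exists (C * D); first exact: mulr_ge0.
apply: near0_imp2 fC gD _ => H _ fH gH; apply: le_trans (mnormM _ _) _.
rewrite mulrAC; apply: ler_pM => //; exact: mnorm_ge0.
Qed.

Lemma bigO_mull m n q (f : X -> 'M[R]_(m, n)) (g : X -> 'M[R]_(n, q)) :
  bounded f -> bigO g -> bigO (fun H => f H *m g H).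
Proof.
move=> [C C_ge0 fC] [D D_ge0 gD]; exists (C * D); first exact: mulr_ge0.
apply: near0_imp2 fC gD _ => H _ fH gH; apply: le_trans (mnormM _ _) _.
rewrite -mulrA; apply: ler_pM => //; exact: mnorm_ge0.
Qed.

Lemma littleo_mul m n q (f : X -> 'M[R]_(m, n)) (g : X -> 'M[R]_(n, q)) :
  bigO f -> bigO g -> littleo (fun H => f H *m g H).
Proof.
move=> fO [D D_ge0 gD] e e_gt0; have D1_gt0 : 0 < D + 1 by lra.
have := bigO_small fO (divr_gt0 e_gt0 D1_gt0) => f_small.
apply: near0_imp2 f_small gD _ => H _; rewrite ltr_pdivlMr // => fH gH.
apply: le_trans (mnormM _ _) _; have := mnorm_ge0 H; have := mnorm_ge0 (f H).
have := mnorm_ge0 (g H) => g0 f0 H0.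
apply: le_trans (ler_wpM2l f0 gH) _; rewrite mulrA ler_wpM2r //.
by apply: le_trans (ltW fH); rewrite ler_wpM2l //; lra.
Qed.

Lemma bigO_blk (j : nat) : (j < k)%N -> bigO (fun H => blk H j).
Proof.
move=> lt_jk; exists 1 => //; apply: near0_all => H _; rewrite mul1r.
rewrite -[in leRHS](blockcol_blk H) mnorm_blockcol (bigD1 (Ordinal lt_jk)) //= lerDl.
by apply: sumr_ge0 => i _; apply: mnorm_ge0.
Qed.

Lemma bigO_blockcol m (B : X -> nat -> 'M[R]_p) :
  (forall i, (i < m)%N -> bigO (fun H => B H i)) -> bigO (fun H => blockcol m (B H)).
Proof.
elim: m => [|m IHm] BO.
  exists 0 => //; apply: near0_all => H _.
  by rewrite mnorm_blockcol big_ord0 mul0r.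
have [C C_ge0 BC] := IHm (fun i lt_i => BO i (ltnW lt_i)).
have [D D_ge0 BD] := BO m (ltnSn m).
exists (C + D); first exact: addr_ge0.
apply: near0_imp2 BC BD _ => H _ BH BmH; rewrite mnorm_blockcol big_ord_recr /=.
by rewrite mulrDl lerD // -mnorm_blockcol.
Qed.

Lemma bigO_blockmx m n (B : X -> nat -> nat -> 'M[R]_p) :
  (forall i j, (i < m)%N -> (j < n)%N -> bigO (fun H => B H i j)) ->
  bigO (fun H => blockmx m n (B H)).
Proof.
move=> BO; elim: m BO => [|m IHm] BO.
  exists 0 => //; apply: near0_all => H _.
  by rewrite mnorm_blockmx big_ord0 mul0r.
have [C C_ge0 BC] := IHm (fun i j lt_i => BO i j (ltnW lt_i)).
have [D D_ge0 BD] : bigO (fun H => blockcol n (B H m)).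
  by apply: bigO_blockcol => j; apply: BO.
exists (C + D); first exact: addr_ge0.
apply: near0_imp2 BC BD _ => H _ BH BmH; rewrite mnorm_blockmx big_ord_recr /=.
by rewrite mulrDl lerD // -?mnorm_blockmx // -mnorm_blockcol.
Qed.

Lemma bigO_mom (W : X -> nat -> 'M[R]_p) f :
  (forall i, bigO (fun H => W H i)) -> bigO (fun H => mom (W H) f).
Proof.
move=> WO; apply: (@bigO_sum _ _ _ (fun i H => f`_i *: W H i)) => i _.
exact/bigOZ/WO.
Qed.

(* The residual vanishes at the unperturbed (scalar) data by orthogonality, so
   that the error is quadratic in the perturbation. *)
Lemma littleo_schur_error (W : X -> nat -> 'M[R]_p) (w : nat -> R) c f :
  (forall i, bigO (fun H => W H i - w i *: 1%:M)) ->
  (\matrix_(i < c, j < c) w (i + j)%N) \in unitmx ->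
  (forall i, (i < c)%N -> mom (w : nat -> R^o) ('X^i * f) = 0) ->
  near0 (fun H => hankel (W H) c \in unitmx) /\
  littleo (fun H => schur_error (W H) c f).
Proof.
move=> Ww uw wf.
have [i j|K KH0] := @blockmx_scalar_inv _ p _ _ (fun i j => w (i + j)%N) uw.
  by rewrite mxE.
set H0 := blockmx c c _ in KH0.
have HO : bigO (fun H => hankel (W H) c - H0).
  apply: bigO_near (bigO_blockmx (m := c) (n := c) (fun i j _ _ => Ww (i + j)%N)).
  by apply: near0_all => H _; rewrite blockmxB.
(* The inverse of this number bounds the deviation so that its product with [mnorm K] is at most one
   half, as [perturb_inv] asks, also when [mnorm K] is 0. *)
have K1_gt0 : 0 < 2 * (mnorm K + 1) by have := mnorm_ge0 K; lra.
have inv_near : near0 (fun H => hankel (W H) c \in unitmx /\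
    mnorm (invmx (hankel (W H) c)) <= 2 * mnorm K).
  apply: near0_imp (bigO_small HO (_ : 0 < (2 * (mnorm K + 1))^-1)) _.
    by rewrite invr_gt0.
  move=> H _ small; apply: perturb_inv KH0 _; move: small.
  rewrite -[_^-1]mul1r ltr_pdivlMr //; have := mnorm_ge0 K.
  have := mnorm_ge0 (hankel (W H) c - H0); nra.
have inv_bdd : bounded (fun H => invmx (hankel (W H) c)).
  exists (2 * mnorm K); first by rewrite mulr_ge0 ?mnorm_ge0.
  by apply: near0_imp inv_near _ => H _ [].
split; first by apply: near0_imp inv_near _ => H _ [].
have res : bigO (fun H => residual (W H) c f).
  apply: bigO_blockcol => i lt_ic.
  apply: bigO_near (bigO_mom ('X^i * f) Ww); apply: near0_all => H _.
  rewrite mom_seqB mom_scaled -[X in X *: _]/(mom (w : nat -> R^o) ('X^i * f)).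
  by rewrite wf // scale0r subr0.
have := littleo_mul (bigO_tr res) (bigO_mull inv_bdd res).
by apply: littleo_near; apply: near0_all => H _; rewrite mulmxA.
Qed.

End Asymptotics.

(** * The inverse of the canonical moment map *)

Section MomentSpace.
Variables (R : rcfType) (p k : nat).
Local Notation X := 'M[R]_(k * p, p).
Implicit Types (S : nat -> 'M[R]_p) (U M : X) (n j : nat).

Definition arcmom j : R := cosmom R j.*2 0.
Definition range S n := Splus S n - Sminus S n.
(** Solves the definition of the canonical moment for the moment. Blocks are numbered from 0, so
    [blk U n] is the canonical moment of order [n.+1]. *)
Definition next_moment S n U : 'M[R]_p :=
  Sminus S n.+1 + msqrt (range S n.+1) *m blk U n *m msqrt (range S n.+1).

(* The moments of [U] up to order [n], continued by the arcsine moments. *)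
Fixpoint moments U n : nat -> 'M[R]_p :=
  if n is n'.+1 then
    fun j => if j == n then next_moment (moments U n') n' U else moments U n' j
  else fun j => arcmom j *: 1%:M.

(** For [n = 0] the block matrices are empty and the general formula returns the conventional value;
    with [SplusS] this removes the special case of order 1. *)
Lemma SminusS S n : Sminus S n.+1 = Sminus_step S n.
Proof.
by case: n => [|n] //; apply/matrixP => i j; rewrite !mxE big1 // => -[].
Qed.

Lemma SplusS S n : S 0%N = 1%:M -> Splus S n.+1 = Splus_step S n.
Proof.
case: n => [|n] // S0; rewrite /= /Splus_step S0 -[LHS]subr0; congr (_ - _).
by apply/matrixP => i j; rewrite !mxE big1 // => -[].
Qed.

(** The block formulas for order [n.+1] reach only moments up to [n]; this makes the passage between
    moments and canonical moments triangular. *)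
Lemma eq_bounds S1 S2 n : (forall j, (j <= n)%N -> S1 j = S2 j) ->
  Sminus S1 n.+1 = Sminus S2 n.+1 /\ Splus S1 n.+1 = Splus S2 n.+1.
Proof.
move=> eqS; case: n eqS => [//|n] eqS.
have half_n := odd_double_half n.+1; have uphalf_n := uphalf_half n.+1.
have parity : (odd n.+1 <= 1)%N by case: (odd _).
rewrite /Sminus /Splus /Sminus_step /Splus_step; split.
  have -> : blockcol (uphalf n.+1) (fun i => S1 (n.+1./2 + 1 + i)%N) =
            blockcol (uphalf n.+1) (fun i => S2 (n.+1./2 + 1 + i)%N).
    by apply: eq_blockcol => i lt_i; apply: eqS; lia.
  have -> // : blockmx (uphalf n.+1) (uphalf n.+1) (fun i j => S1 (i + j + ~~ odd n.+1)%N) =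
            blockmx (uphalf n.+1) (uphalf n.+1) (fun i j => S2 (i + j + ~~ odd n.+1)%N).
  by apply: eq_blockmx => i j lt_i lt_j; apply: eqS; case: (odd n.+1) half_n uphalf_n => /=; lia.
congr (_ - _); first exact: eqS.
have -> : blockcol n.+1./2 (fun i => S1 (uphalf n.+1 + i)%N - S1 (uphalf n.+1 + i + 1)%N) =
          blockcol n.+1./2 (fun i => S2 (uphalf n.+1 + i)%N - S2 (uphalf n.+1 + i + 1)%N).
  by apply: eq_blockcol => i lt_i; rewrite !eqS //; lia.
have -> // : blockmx n.+1./2 n.+1./2
    (fun i j => S1 (i + j + odd n.+1)%N - S1 (i + j + odd n.+1 + 1)%N) =
  blockmx n.+1./2 n.+1./2
    (fun i j => S2 (i + j + odd n.+1)%N - S2 (i + j + odd n.+1 + 1)%N).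
by apply: eq_blockmx => i j lt_i lt_j; rewrite !eqS //; lia.
Qed.

Lemma eq_next_moment S1 S2 n U : (forall j, (j <= n)%N -> S1 j = S2 j) ->
  next_moment S1 n U = next_moment S2 n U.
Proof. by move=> /eq_bounds[eqm eqp]; rewrite /next_moment /range eqm eqp. Qed.

Lemma moments0 U n : moments U n 0%N = 1%:M.
Proof. by elim: n => [|n IHn] //=; rewrite /arcmom scale1r. Qed.

Lemma moments_stable U n m j : (j <= n <= m)%N -> moments U m j = moments U n j.
Proof.
move=> /andP[le_jn]; elim: m => [|m IHm]; first by rewrite leqn0 => /eqP->.
rewrite leq_eqVlt ltnS => /orP[/eqP<- //|le_nm] /=.
by rewrite (_ : j == m.+1 = false) ?IHm //; apply/eqP; lia.
Qed.

Lemma momentsS U n m : (n < m)%N -> moments U m n.+1 = next_moment (moments U m) n U.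
Proof.
move=> lt_nm; rewrite (@moments_stable U n.+1) ?lt_nm ?andbT //= eqxx.
apply: eq_next_moment => j le_jn; rewrite (@moments_stable U n m) // le_jn.
exact: ltnW.
Qed.

Lemma range_posdef S j : loew_lt (Sminus S j) (S j) -> loew_lt (S j) (Splus S j) ->
  posdef (range S j).
Proof.
move=> [_ [_ pm]] [_ [_ pp]].
by rewrite /range -(subrK (S j) (Splus S j)) -addrA; apply: posdefD.
Qed.

(** Uniqueness of the preimage: the strict inequalities make the root of the range invertible, so
    the conjugation in [canmom] can be undone and each moment is recovered from the earlier ones. *)
Lemma phi_moments U M : IntMk M -> phi M = U ->
  forall n, (n <= k)%N -> Sseq M n = moments U k n.
Proof.
move=> [_ intM] phiM; elim/ltn_ind => -[|n] IHn le_nk; first by rewrite moments0.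
have [lt_m lt_p] := intM n.+1 le_nk.
have uY := msqrt_unit (range_posdef lt_m lt_p).
rewrite momentsS // -(@eq_next_moment (Sseq M)) => [|j le_jn]; last first.
  by apply: IHn => //; apply: leq_trans le_jn (ltnW le_nk).
rewrite /next_moment -phiM blk_blockcol // /canmom -/(range _ _).
by rewrite !mulmxA mulmxV // mul1mx mulmxKV // addrC subrK.
Qed.

Lemma blk_inj (M N : X) : (forall j, (j < k)%N -> blk M j = blk N j) -> M = N.
Proof. by move=> eqMN; rewrite -(blockcol_blk M) -(blockcol_blk N); apply: eq_blockcol. Qed.

Definition admissible S n := loew_lt (Sminus S n) (S n) /\ loew_lt (S n) (Splus S n).

(** [phi_inv] chooses a preimage. Admissibility shows that the reconstructed moments form one, and
    [phi_moments] that every preimage equals it. *)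
Lemma phi_inv_moments U : (forall n, (n < k)%N -> admissible (moments U k) n.+1) ->
  phi_inv U = blockcol k (fun i => moments U k i.+1).
Proof.
move=> admU; set M := blockcol k _.
have SM n : (n <= k)%N -> Sseq M n = moments U k n.
  by case: n => [|n] le_nk; [rewrite moments0 | rewrite /= blk_blockcol].
have boundsM n : (n < k)%N -> Sminus (Sseq M) n.+1 = Sminus (moments U k) n.+1 /\
    Splus (Sseq M) n.+1 = Splus (moments U k) n.+1.
  by move=> lt_nk; apply: eq_bounds => j le_jn; apply: SM; apply: leq_trans le_jn (ltnW lt_nk).
have intM : IntMk M.
  split=> [j lt_jk|[|n] // le_nk].
    by rewrite blk_blockcol //; have [[_ []]] := admU j lt_jk.
  have [-> ->] := boundsM n le_nk; rewrite SM //; exact: admU.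
have phiM : phi M = U.
  apply: blk_inj => n lt_nk; rewrite blk_blockcol // /canmom.
  have [-> ->] := boundsM n lt_nk; rewrite SM // momentsS // -/(range _ _).
  have [lt_m lt_p] := admU n lt_nk.
  have uY := msqrt_unit (range_posdef lt_m lt_p).
  by rewrite /next_moment addrC addKr !mulmxA mulVmx // mul1mx mulmxK.
have [] := ClassicalEpsilon.epsilon_spec (inhabits 0) (fun M => IntMk M /\ phi M = U)
  (ex_intro _ M (conj intM phiM)).
rewrite -/(phi_inv U) => int_inv phi_invU.
apply: blk_inj => n lt_nk; rewrite blk_blockcol //.
exact: phi_moments int_inv phi_invU n.+1 lt_nk.
Qed.

Lemma blk_U0 H j : (j < k)%N -> blk (U0 R p k + H) j = 2^-1 *: 1%:M + blk H j.
Proof. by move=> lt_jk; rewrite blkD // blk_blockcol. Qed.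

End MomentSpace.

(** * Linearization *)

Section Perturbation.
Variables (R : rcfType) (p k : nat).
Local Notation X := 'M[R]_(k * p, p).
Local Notation arcmom := (arcmom R).

(** Symmetric moment sequences within [O(H)] of the arcsine moments, the setting in which the Schur
    errors are [o(H)]. *)
Definition regular (S : X -> nat -> 'M[R]_p) :=
  [/\ forall H, S H 0%N = 1%:M, near0 (fun H => forall j, sym (S H j)) &
      forall j, bigO (fun H => S H j - arcmom j *: 1%:M)].

Lemma minus_regular S n : regular S ->
  near0 (fun H => hankel (minusW (S H) n) (uphalf n) \in unitmx) /\
  littleo (fun H => minus_error (S H) n).
Proof.
move=> [_ _ SO].
apply: (@littleo_schur_error _ _ _ _ (fun i => arcmom (i + ~~ odd n)%N)) => [i||i lt_i].
- exact: SO.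
- exact: hankelP_unit.
rewrite -(@momXn _ R^o arcmom) -scalerAr -scalerAr (@momZ _ R^o) mulrCA.
rewrite -[mom _ _]/(momcos 0 ('X^i * (wP R n.+1 * chebP R n.+1))).
have [-> _] := momcos_wPQ R n i.
(* For [i < uphalf n] the power [i.*2 + ~~ odd n] stays below the frequency [n.+1]. *)
by rewrite cosmom_small ?scaler0 //; have [] := half_parity n; lia.
Qed.

Lemma plus_regular S n : regular S ->
  near0 (fun H => hankel (plusW (S H) n) n./2 \in unitmx) /\
  littleo (fun H => plus_error (S H) n).
Proof.
move=> [_ _ SO].
apply: (@littleo_schur_error _ _ _ _ (fun i => arcmom (i + odd n)%N - arcmom (i + odd n).+1)) => [i||i lt_i].
- apply: bigO_near (bigOB (SO (i + odd n)%N) (SO (i + odd n).+1)).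
  apply: near0_all => H _; rewrite /plusW scalerBl.
  by apply/matrixP => a b; rewrite !mxE; ring.
- exact: hankelQ_unit.
rewrite (@mom_wQ _ R^o arcmom) -scalerAr -scalerAr (@momZ _ R^o) mulrCA.
rewrite -[mom _ _]/(momcos 0 ('X^i * (wQ R n.+1 * chebQ R n.+1))).
have [_ ->] := momcos_wPQ R n i.
by rewrite !cosmom_small ?subrr ?mulr0 ?scaler0 //; have [_] := half_parity n; lia.
Qed.

Lemma range_regular S n : regular S ->
  littleo (fun H => range (S H) n.+1 - 4 ^- n *: 1%:M).
Proof.
move=> regS; have [S0 symS _] := regS.
have [uP eP] := minus_regular n regS; have [uQ eQ] := plus_regular n regS.
apply: littleo_near (littleoZ (-1) (littleoD eQ eP)).
apply: near0_imp2 symS (near0_and uP uQ) _ => H _ symH [uPH uQH].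
by rewrite /range SminusS SplusS // S_range // addrAC subrr add0r scaleN1r.
Qed.

Lemma schur_sym (W : nat -> 'M[R]_p) c : (forall i, sym (W i)) -> sym (schur W c).
Proof.
by move=> symW; rewrite /sym /schur !trmx_mul trmxK trmx_inv hankel_tr // mulmxA.
Qed.

Lemma bounds_sym (S : nat -> 'M[R]_p) n : S 0%N = 1%:M -> (forall j, sym (S j)) ->
  sym (Sminus S n.+1) /\ sym (Splus S n.+1).
Proof.
move=> S0 symS; rewrite SminusS SplusS // Sminus_schur Splus_schur; split.
  by apply: schur_sym => i; apply: symS.
rewrite /sym linearB /= symS schur_sym // => i.
by rewrite /sym linearB /= !symS.
Qed.

Lemma near_posdef (D : X -> 'M[R]_p) d : 0 < d -> near0 (fun H => sym (D H)) ->
  bigO (fun H => D H - d *: 1%:M) -> near0 (fun H => posdef (D H)).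
Proof.
move=> d_gt0 symD /bigO_small/(_ d_gt0) D_small.
by apply: near0_imp2 symD D_small _ => H _; apply: posdef_near.
Qed.

Lemma near_bounds_sym S n : regular S ->
  near0 (fun H => sym (Sminus (S H) n.+1) /\ sym (Splus (S H) n.+1)).
Proof.
by move=> [S0 symS _]; apply: near0_imp symS _ => H _; apply: bounds_sym.
Qed.

Lemma near_range_posdef S n : regular S -> near0 (fun H => posdef (range (S H) n.+1)).
Proof.
move=> regS; apply: (@near_posdef _ (4 ^- n)); first by rewrite invr_gt0 exprn_gt0.
  by apply: near0_imp (near_bounds_sym n regS) _ => H _ [sm sp]; rewrite /sym linearB /= sm sp.
exact/littleo_bigO/range_regular.
Qed.

Lemma near_msqrt S n : regular S ->
  near0 (fun H => psd (msqrt (range (S H) n.+1)) /\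
    msqrt (range (S H) n.+1) *m msqrt (range (S H) n.+1) = range (S H) n.+1).
Proof.
by move=> regS; apply: near0_imp (near_range_posdef n regS) _ => H _ /posdef_psd/msqrtP.
Qed.

(** [psd_sqrt_near] with [d = 2 ^- n] bounds the deviation of the root linearly by that of the
    range. *)
Lemma msqrt_regular S n : regular S ->
  bigO (fun H => msqrt (range (S H) n.+1) - 2 ^- n *: 1%:M).
Proof.
move=> regS; have [C C_ge0 DC] := littleo_bigO (range_regular n regS).
have d_gt0 : 0 < 2 ^- n :> R by rewrite invr_gt0 exprn_gt0.
exists ((p * p)%:R / 2 ^- n * C); first by rewrite mulr_ge0 // divr_ge0 // ltW.
apply: near0_imp2 DC (near_msqrt n regS) _ => H _ DH [psdY YY].
apply: le_trans (psd_sqrt_near psdY d_gt0) _.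
rewrite YY -invfM -exprMn -natrM -[leRHS]mulrA ler_wpM2l //.
by rewrite divr_ge0 // ltW.
Qed.

(** [blk H n] is already of first order, so replacing each root by [2 ^- n] costs only products of
    two first-order factors. *)
Lemma msqrt_conj_regular S n : regular S -> (n < k)%N ->
  littleo (fun H => msqrt (range (S H) n.+1) *m blk H n *m msqrt (range (S H) n.+1)
    - 4 ^- n *: blk H n).
Proof.
move=> regS lt_nk; have YO := msqrt_regular n regS.
have hO := @bigO_blk R p k n lt_nk; have Yb := bigO_bounded YO.
set Y := fun H => msqrt (range (S H) n.+1) in YO Yb *.
have L1 : littleo (fun H => (Y H - 2 ^- n *: 1%:M) *m (blk H n *m Y H)).
  exact: littleo_mul YO (bigO_mulr hO Yb).
have L2 : littleo (fun H => 2 ^- n *: (blk H n *m (Y H - 2 ^- n *: 1%:M))).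
  exact/littleoZ/(littleo_mul hO YO).
apply: littleo_near (littleoD L1 L2); apply: near0_all => H _.
rewrite mulmxBl mulmxBr -scalemxAl mul1mx -scalemxAr mulmx1 scalerBr scalerA.
by rewrite -invfM -exprMn -natrM mulmxA addrA subrK.
Qed.

(** Both gaps are half the range plus or minus a first-order term, hence close to the positive
    multiple [2^-1 * 4 ^- n] of the identity. *)
Lemma near_admissible S n : regular S -> (n < k)%N ->
  near0 (fun H => S H n.+1 = next_moment (S H) n (U0 R p k + H)) ->
  near0 (fun H => admissible (S H) n.+1).
Proof.
move=> regS lt_nk S_next; have [S0 symS _] := regS.
pose Y H := msqrt (range (S H) n.+1); pose Z H := Y H *m blk H n *m Y H.
have ZO : bigO Z.
  have := bigOD (littleo_bigO (msqrt_conj_regular regS lt_nk)) (bigOZ (4 ^- n) (@bigO_blk R p k n lt_nk)).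
  by apply: bigO_near; apply: near0_all => H _; rewrite subrK.
have dO := littleo_bigO (range_regular n regS).
have d_gt0 : 0 < 2^-1 * 4 ^- n :> R by rewrite mulr_gt0 ?invr_gt0 ?exprn_gt0.
have lowE : near0 (fun H => S H n.+1 - Sminus (S H) n.+1 = 2^-1 *: range (S H) n.+1 + Z H).
  apply: near0_imp2 S_next (near_msqrt n regS) _ => H _ -> [_ YY].
  rewrite /next_moment addrC addKr blk_U0 // mulmxDr mulmxDl.
  by rewrite -scalemxAr mulmx1 -scalemxAl YY.
have highE : near0 (fun H => Splus (S H) n.+1 - S H n.+1 = 2^-1 *: range (S H) n.+1 - Z H).
  apply: near0_imp lowE _ => H _ lowH.
  have -> : Splus (S H) n.+1 - S H n.+1 = range (S H) n.+1 - (S H n.+1 - Sminus (S H) n.+1).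
    by rewrite /range opprB addrA subrK.
  rewrite lowH opprD addrA -{1}[range _ _]scale1r -scalerBl; congr (_ *: _ + _).
  by field.
have symB := near_bounds_sym n regS.
have sym_near : near0 (fun H => [/\ sym (S H n.+1), sym (Sminus (S H) n.+1) & sym (Splus (S H) n.+1)]).
  by apply: near0_imp2 symS symB _ => H _ sH [].
have half_bigO s : bigO (fun H => 2^-1 *: range (S H) n.+1 + s *: Z H - (2^-1 * 4 ^- n) *: 1%:M).
  apply: bigO_near (bigOD (bigOZ 2^-1 dO) (bigOZ s ZO)); apply: near0_all => H _.
  by rewrite [in RHS]scalerBr scalerA addrAC.
have pm : near0 (fun H => posdef (S H n.+1 - Sminus (S H) n.+1)).
  apply: near_posdef d_gt0 _ _.
    by apply: near0_imp sym_near _ => H _ [s0 s1 _]; rewrite /sym linearB /= s0 s1.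
  apply: bigO_near (half_bigO 1); apply: near0_imp lowE _ => H _ ->.
  by rewrite scale1r.
have pp : near0 (fun H => posdef (Splus (S H) n.+1 - S H n.+1)).
  apply: near_posdef d_gt0 _ _.
    by apply: near0_imp sym_near _ => H _ [s0 _ s1]; rewrite /sym linearB /= s0 s1.
  apply: bigO_near (half_bigO (-1)); apply: near0_imp highE _ => H _ ->.
  by rewrite scaleN1r.
by apply: near0_imp2 sym_near (near0_and pm pp) _ => H _ [? ? ?] [].
Qed.

(** The predicted expansion. Terms with [l.+1 > j] vanish by [cosmom_small]; the factor 4 turns the
    one half of [momcos_cheb] into the 2 of [mom_linear_part]. *)
Definition linear_part (H : X) j : 'M[R]_p :=
  arcmom j *: 1%:M + \sum_(l < k) (4 * cosmom R j.*2 l.+1.*2) *: blk H l.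

(** By [momcos_cheb] the sequences [cosmom R j.*2 l.+1.*2] in [j] are dual to the polynomials
    [cheb R n.+1], so a single term of the sum survives. *)
Lemma mom_linear_part H n : (n < k)%N ->
  mom (linear_part H) (cheb R n.+1) = 2 *: blk H n.
Proof.
move=> lt_nk; rewrite mom_seqD mom_scaled.
rewrite -[X in X *: _]/(momcos 0.*2 (cheb R n.+1)) momcos_cheb /= mulr0 scale0r add0r.
transitivity (\sum_(l < k) (4 * momcos l.+1.*2 (cheb R n.+1)) *: blk H l).
  rewrite /mom; under eq_bigr => i _ do rewrite scaler_sumr.
  rewrite exchange_big /=; apply: eq_bigr => l _.
  rewrite /momcos /mom mulr_sumr scaler_suml; apply: eq_bigr => i _.
  by rewrite scalerA; congr (_ *: _); rewrite /GRing.scale /=; ring.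
rewrite (bigD1 (Ordinal lt_nk)) //= big1 ?addr0 => [|l ne_l].
  by rewrite momcos_cheb eqxx mulr1; congr (_ *: _); field.
rewrite momcos_cheb eqSS (_ : (l == n :> nat) = false) ?mulr0 ?scale0r //.
by apply: contraNF ne_l => /eqP eq_l; apply/eqP/val_inj.
Qed.

Lemma mom_cheb_recr (s : nat -> 'M[R]_p) n : mom s (cheb R n.+1) =
  \sum_(i < n.+1) (cheb R n.+1)`_i *: s i + (2 * 4 ^+ n) *: s n.+1.
Proof.
have [small lead] := coef_cheb R n.
rewrite (@mom_wide _ _ _ _ n.+2); last by apply/leq_sizeP.
by rewrite big_ord_recr /= lead.
Qed.

(** In [S_center] the top term of [mom S (cheb R n.+1)] cancels [S n.+1], so the centre depends on
    lower moments only, up to the Schur errors. The hypothesis handles those moments, and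
    [mom_linear_part] gives the matching triangular relation for the linear part. *)
Lemma next_moment_linear S n : regular S -> (n < k)%N ->
  (forall j, (j <= n)%N -> littleo (fun H => S H j - linear_part H j)) ->
  littleo (fun H => next_moment (S H) n (U0 R p k + H) - linear_part H n.+1).
Proof.
move=> regS lt_nk IH; have [S0 symS _] := regS.
have [uP eP] := minus_regular n regS; have [uQ eQ] := plus_regular n regS.
have E0 : littleo (fun H =>
    \sum_(i < n.+1) (cheb R n.+1)`_i *: (S H i - linear_part H i)).
  apply: (@littleo_sum _ _ _ _ _ _ (fun i H => (cheb R n.+1)`_i *: (S H i - linear_part H i))).
  by move=> i lt_i; apply/littleoZ/IH.
(* Three sources of error: the Schur errors of the two bounds, the lower moments, and the
   conjugation by the root of the range. *)
have := littleoD (littleoB (littleoZ 2^-1 (littleoB eP eQ)) (littleoZ (2 * 4 ^+ n)^-1 E0))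
  (msqrt_conj_regular regS lt_nk).
apply: littleo_near.
apply: near0_imp2 (near0_and symS (near_msqrt n regS)) (near0_and uP uQ) _.
move=> H _ [symH [_ YY]] [uPH uQH]; rewrite /next_moment blk_U0 //.
set Y := msqrt _ in YY *; rewrite mulmxDr mulmxDl -scalemxAr mulmx1 -scalemxAl YY.
have := mom_linear_part H lt_nk; rewrite mom_cheb_recr.
have := S_center symH uPH uQH; rewrite mom_cheb_recr -SminusS -SplusS // -/(range _ _).
have q_neq0 : 4 ^+ n != 0 :> R by rewrite expf_neq0 // pnatr_eq0.
under [X in _ -> _ -> _ = _ - _ *: X + _]eq_bigr => i _ do rewrite scalerBr.
rewrite sumrB addrA => ->.
set A := \sum_(i < n.+1) _; set B := \sum_(i < n.+1) _.
set e := minus_error _ _ - _; set y := Y *m _ *m _; set h := blk H n.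
set l := linear_part H n.+1; set s := S H n.+1.
have scal2 : 2 * 4 ^+ n != 0 :> R by rewrite mulf_neq0 // pnatr_eq0.
move: A B e y h l s => A B e y h l s lin.
have -> : l = (2 * 4 ^+ n)^-1 *: (2 *: h - A).
  by rewrite -lin addrAC subrr add0r scalerA mulVf // scale1r.
by apply/matrixP => i j; rewrite !mxE; field.
Qed.

End Perturbation.

(** * Expansion of the inverse map at the centre *)

Section Differential.
Variables (R : rcfType) (p k : nat).
Local Notation X := 'M[R]_(k * p, p).
Local Notation S n := (fun H : X => moments (U0 R p k + H) n).

Lemma linear_part_bigO j :
  bigO (fun H : X => linear_part H j - arcmom R j *: 1%:M).
Proof.
apply: bigO_near (@bigO_sum _ _ _ _ _ k
  (fun l (H : X) => (4 * cosmom R j.*2 l.+1.*2) *: blk H l) _) => [|l lt_lk].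
  by apply: near0_all => H _; rewrite /linear_part addrC addKr.
exact/bigOZ/bigO_blk.
Qed.

(** Regularity at order [n] yields the expansion of the next moment, which in turn yields regularity
    at order [n.+1]; hence the joint induction. *)
Lemma moments_regular n : (n <= k)%N -> regular (S n) /\
  forall j, (j <= n)%N -> littleo (fun H => S n H j - linear_part H j).
Proof.
elim: n => [|n IHn] le_nk.
  split.
    split=> [H||j]; first exact: moments0.
      by apply: near0_all => H _ j; rewrite /sym linearZ /= trmx1.
    by apply: bigO_near (@bigO0 R p k p p); apply: near0_all => H _; rewrite subrr.
  move=> j; rewrite leqn0 => /eqP->.
  apply: littleo_near (@littleo0 R p k p p); apply: near0_all => H _.
  rewrite /linear_part big1 ?addr0 ?subrr // => l _.
  by rewrite mulr0 scale0r.
have [regS linS] := IHn (ltnW le_nk); have [S0 symS SO] := regS.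
have next_lin := next_moment_linear regS le_nk linS.
have next_sym : near0 (fun H => sym (next_moment (S n H) n (U0 R p k + H))).
  apply: near0_imp2 (near_bounds_sym n regS) (near_msqrt n regS) _.
  move=> H symH [sm _] [[sY _] _]; rewrite /next_moment blk_U0 // /sym linearD /= sm.
  by rewrite !trmx_mul sY linearD linearZ /= trmx1 (symH n) // mulmxA.
split=> [|j].
  split=> [H||j]; first exact: moments0.
    by apply: near0_imp2 symS next_sym _ => H _ symH symN j /=; case: eqP.
  rewrite /=; case: (j =P n.+1) => [->|_]; last exact: SO.
  apply: bigO_near (bigOD (littleo_bigO next_lin) (linear_part_bigO n.+1)).
  by apply: near0_all => H _; rewrite addrA subrK.
rewrite leq_eqVlt => /orP[/eqP->|lt_j] /=; first by rewrite eqxx.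
by rewrite (ltn_eqF lt_j); apply: linS.
Qed.

Lemma phi_inv_near : near0 (fun H : X =>
  phi_inv (U0 R p k + H) = blockcol k (fun i => S k H i.+1)).
Proof.
have [regS _] := moments_regular (leqnn k).
apply: near0_imp (near0_ltn _) (fun H _ => @phi_inv_moments R p k (U0 R p k + H)) => n lt_nk.
apply: (near_admissible regS lt_nk).
by apply: near0_all => H _; apply: momentsS.
Qed.

(** Indices start at 0, so row [i] is row [i+1] of [A]; the factor 4 turns the power [2^(-2i-2)]
    from [cosmom_binomial] into [2^(-2i)]. *)
Lemma Amat_cosmom (i l : 'I_k) : Amat R k i l = 4 * cosmom R i.+1.*2 l.+1.*2.
Proof.
rewrite mxE; case: leqP => [le_li|lt_il]; last first.
  by rewrite cosmom_small ?mulr0 // ltn_double ltnS.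
have -> : (i.+1.*2 = l.+1.*2 + (i - l).*2)%N by lia.
rewrite cosmom_binomial.
have -> : (l.+1.*2 + (i - l).*2 = (2 * i).+2)%N by lia.
have -> : (2 * i.+1 = (2 * i).+2)%N by lia.
rewrite mulrA !exprS; congr (_ * _); field.
by rewrite expf_neq0 // pnatr_eq0.
Qed.

Lemma kronI_mul (H : X) : kronI p (Amat R k) *m H =
  blockcol k (fun i => linear_part H i.+1 - arcmom R i.+1 *: 1%:M).
Proof.
rewrite -{1}(blockcol_blk H) mulmx_blockcol; apply: blockcol_eqP => i a b.
rewrite !blockcolE; congr ((_ : 'M_p) a b).
rewrite /linear_part addrC addKr; apply: eq_bigr => l _.
by rewrite -scalemxAl mul1mx ent_ord Amat_cosmom.
Qed.

End Differential.

Theorem theorem4p5 (R : rcfType) (p k : nat) :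
  mx_diff_at (@phi_inv R p k) (U0 R p k) (kronI p (Amat R k)).
Proof.
have [regS linS] := moments_regular R p (leqnn k).
have sum_lin : forall e : R, 0 < e -> near0 (fun H : 'M[R]_(k * p, p) =>
    \sum_(i < k) mnorm (moments (U0 R p k + H) k i.+1 - linear_part H i.+1) <= e * mnorm H).
  (* The tolerance is split over the [k] blocks; the [+ 1] covers [k = 0]. *)
  move=> e e_gt0; have k1_gt0 : 0 < k%:R + 1 :> R by rewrite ltr_wpDl.
  apply: near0_imp (near0_ltn (N := k) (fun i lt_ik => linS i.+1 lt_ik _ (divr_gt0 e_gt0 k1_gt0))) _.
  move=> H _ small.
  apply: (@le_trans _ _ (\sum_(i < k) e / (k%:R + 1) * mnorm H)).
    by apply: ler_sum => i _; apply: small.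
  rewrite sumr_const card_ord -[leLHS]mulr_natl mulrA ler_wpM2r ?mnorm_ge0 //.
  by rewrite ?mulrA ler_pdivrMr // mulrC; nra.
move=> e e_gt0.
have [d d_gt0 near_d] := near0_and (phi_inv_near R p k) (sum_lin e e_gt0).
exists d => // H symH lt_d; have [phiH sumH] := near_d H symH lt_d.
have sym0 : symblocks (0 : 'M[R]_(k * p, p)).
  move=> j lt_jk; rewrite /sym; apply/matrixP => a b.
  by rewrite -[j]/(val (Ordinal lt_jk)) mxE !blkE !mxE.
(* [H = 0] lies in every neighbourhood, so the same description holds for [phi_inv] at the centre
   itself. *)
have [|phi0 sum0] := near_d 0 sym0; first by rewrite mnorm0.
have mom0 i : (i < k)%N -> moments (U0 R p k + 0) k i.+1 = arcmom R i.+1 *: 1%:M.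
  move=> lt_ik; have -> : arcmom R i.+1 *: 1%:M = linear_part (0 : 'M[R]_(k * p, p)) i.+1.
    rewrite /linear_part big1 ?addr0 // => l _.
    by apply/matrixP => a b; rewrite mxE blkE !mxE mulr0.
  (* At [H = 0] the error bound is 0, so the linear prediction is exact there. *)
  apply/eqP; rewrite -subr_eq0; apply/eqP/mnorm_le0.
  move: sum0; rewrite mnorm0 mulr0; apply: le_trans.
  rewrite (bigD1 (Ordinal lt_ik)) //= lerDl.
  by apply: sumr_ge0 => l _; apply: mnorm_ge0.
rewrite -{2}[U0 R p k]addr0 phiH phi0 kronI_mul !blockcolB mnorm_blockcol.
apply: le_trans sumH; apply: ler_sum => i _.
by rewrite mom0 // opprB addrA subrK.
Qed.
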